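(* There is an algorithm that, given a hypergraph $\mathcal{H}=(V,E)$ of dimension at most $3$ and maximum degree $\Delta$, decides whether the dual hypergraph $\mathcal{H}^d$ is conformal, in time $\mathcal{O}(|E||V|^{2}\Delta^2+|E||V|^{3})$.
   Context: A hypergraph is a pair $\mathcal{H}=(V,E)$ with $V$ a finite nonempty set of vertices and $E$ a set of subsets of $V$ (hyperedges) such that every vertex lies in some hyperedge; it is given by the list of its hyperedges. The dimension is $\max_{e\in E}|e|$; $\Delta$ is the maximum number of hyperedges containing a single vertex. A transversal of $\mathcal{H}$ is a set of vertices intersecting every hyperedge; it is minimal if no proper subset is a transversal. The dual hypergraph $\mathcal{H}^d$ has vertex set $V$ and hyperedges the minimal transversals of $\mathcal{H}$. A hypergraph is conformal if for every set $U$ of vertices such that every pair of vertices of $U$ is contained in some hyperedge, $U$ is contained in some hyperedge. *)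

(* Defs.v *)
From mathcomp Require Import all_boot.

Set Implicit Arguments.
Unset Strict Implicit.
Unset Printing Implicit Defensive.

Section Hypergraphs.

Variable V : finType.

(* A family of subsets of V is given by its set of hyperedges.  Being a
   hypergraph is a separate predicate because the minimal transversals of a
   hypergraph need not cover V when its hyperedges are not an antichain. *)
Implicit Types E F : {set {set V}}.

Definition hypergraph E : bool := (0 < #|V|) && (cover E == [set: V]).

Definition dimension E : nat := \max_(e in E) #|e|.

Definition degree E (v : V) : nat := #|[set e in E | v \in e]|.

Definition max_degree E : nat := \max_(v : V) degree E v.

Definition transversal E (T : {set V}) : bool :=
  [forall e in E, T :&: e != set0].

Definition dual E : {set {set V}} := [set T | minset (transversal E) T].

(* The pairs of vertices of U are its two-element subsets. *)
Definition conformal F : bool :=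
  [forall U : {set V},
     [forall x in U, forall y in U,
        (x != y) ==> [exists e in F, (x \in e) && (y \in e)]]
     ==> [exists e in F, U \subset e]].

(* es lists the hyperedges of E, each exactly once, and each hyperedge as a
   duplicate-free list of its vertices; both orders are arbitrary. *)
Definition edge_list E (es : seq (seq V)) : bool :=
  [&& all uniq es, uniq [seq [set:: e] | e <- es]
    & E == [set:: [seq [set:: e] | e <- es]]].

(* Input words: |V|, |E|, and then every hyperedge as its size followed by the
   labels of its vertices. *)
Definition encode (label : V -> 'I_#|V|) (es : seq (seq V)) : seq nat :=
  [:: #|V|, size es
    & flatten [seq size e :: [seq val (label v) | v <- e] | e <- es]].

End Hypergraphs.

(* A random access machine over natural-number words, with structured control
   flow.  A program mentions finitely many registers; the memory is an array
   addressed by computed words. *)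

Inductive binop := OpAdd | OpSub | OpMul | OpEq | OpLt.

Inductive expr :=
  | Num of nat
  | Reg of nat
  | Fetch of expr
  | Op of binop & expr & expr.

Inductive cmd :=
  | Skip
  | Assign of nat & expr
  | Store of expr & expr
  | Seq of cmd & cmd
  | If of expr & cmd & cmd
  | While of expr & cmd.

Record state := State { regs : nat -> nat; mem : nat -> nat }.

(* OpSub is truncated; OpEq and OpLt return 0 or 1. *)
Definition eval_op (o : binop) (a b : nat) : nat :=
  match o with
  | OpAdd => a + b
  | OpSub => a - b
  | OpMul => a * b
  | OpEq => a == b
  | OpLt => a < b
  end.

Fixpoint eval (s : state) (e : expr) : nat :=
  match e with
  | Num c => c
  | Reg r => regs s r
  | Fetch a => mem s (eval s a)
  | Op o a b => eval_op o (eval s a) (eval s b)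
  end.

(* Every value met while evaluating e, addresses included, is at most W. *)
Fixpoint fits (W : nat) (s : state) (e : expr) : bool :=
  (eval s e <= W) &&
  match e with
  | Num _ | Reg _ => true
  | Fetch a => fits W s a
  | Op _ a b => fits W s a && fits W s b
  end.

Fixpoint cost (e : expr) : nat :=
  match e with
  | Num _ | Reg _ => 1
  | Fetch a => (cost a).+1
  | Op _ a b => (cost a + cost b).+1
  end.

Definition set_reg (s : state) (r v : nat) : state :=
  State [eta regs s with r |-> v] (mem s).

Definition set_mem (s : state) (a v : nat) : state :=
  State (regs s) [eta mem s with a |-> v].

(* exec W p s t s': started in s, p halts in s' after t steps.  A computation
   in which a value exceeds W is stuck: it has no derivation. *)
Inductive exec (W : nat) : cmd -> state -> nat -> state -> Prop :=
  | ExecSkip s : exec W Skip s 1 s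
  | ExecAssign s r e : fits W s e ->
      exec W (Assign r e) s (cost e).+1 (set_reg s r (eval s e))
  | ExecStore s a e : fits W s a -> fits W s e ->
      exec W (Store a e) s (cost a + cost e).+1 (set_mem s (eval s a) (eval s e))
  | ExecSeq p q s t s' t' s'' :
      exec W p s t s' -> exec W q s' t' s'' -> exec W (Seq p q) s (t + t') s''
  | ExecIfTrue e p q s t s' : fits W s e -> eval s e != 0 ->
      exec W p s t s' -> exec W (If e p q) s ((cost e).+1 + t) s'
  | ExecIfFalse e p q s t s' : fits W s e -> eval s e = 0 ->
      exec W q s t s' -> exec W (If e p q) s ((cost e).+1 + t) s'
  | ExecWhileFalse e p s : fits W s e -> eval s e = 0 ->
      exec W (While e p) s (cost e).+1 s
  | ExecWhileTrue e p s t s' t' s'' : fits W s e -> eval s e != 0 ->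
      exec W p s t s' -> exec W (While e p) s' t' s'' ->
      exec W (While e p) s ((cost e).+1 + t + t') s''.

Lemma exec_det W p s t1 s1 t2 s2 :
  exec W p s t1 s1 -> exec W p s t2 s2 -> t1 = t2 /\ s1 = s2.
Proof.
move=> ex1; elim: ex1 t2 s2 => {p s t1 s1}; intros;
  match goal with ex2 : exec _ _ _ ?t ?s |- _ = ?t /\ _ = ?s =>
    inversion ex2; subst end;
  try match goal with nz : is_true (eval ?s ?e != 0), z : eval ?s ?e = 0 |- _ =>
    by rewrite z in nz end;
  repeat match goal with
  | IH : (forall t s, exec W ?p ?a t s -> _), ex : exec W ?p ?a _ _ |- _ =>
    case: (IH _ _ ex) => ? ?; clear IH; subst end;
  by split.
Qed.

(* The input occupies the first memory cells; everything else is zero. *)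
Definition init (input : seq nat) : state := State (fun=> 0) (nth 0 input).

(* The answer is returned in register 0. *)
Definition answers_within (W : nat) (p : cmd) (input : seq nat) (T : nat)
    (b : bool) : Prop :=
  exists t s, [/\ exec W p (init input) t s, t <= T & regs s 0 = b].

(* Main.v *)
(* Write n = |V| and call two vertices u, w adjacent (u = w allowed) when some
   minimal transversal contains both.  This holds iff there are hyperedges e, f
   with u in e, w in f and, unless u = w, w not in e and u not in f, such that no
   hyperedge avoiding u and w lies inside e :|: f: the set {u, w} together with
   the complement of e :|: f is then a transversal, and any minimal transversal
   inside it keeps u and w.
   The dual is conformal iff every clique of this relation extends to a minimal
   transversal, equivalently iff
   - every vertex is adjacent to itself;
   - no clique blocks a hyperedge e, i.e. contains a non-neighbour of every
     vertex of e; as |e| <= 3, three vertices of the clique suffice;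
   - no clique C contains a vertex v all of whose hyperedges meet C outside v; as
     |e| <= 3, for fixed v this is a 2-CNF in the membership variables of C.
   The adjacency matrix takes O(|E|^3) steps by running over triples of
   hyperedges, and |E| = O(|V| Delta); the second test takes O(|E| |V|^3) steps;
   the third one decides n formulas by Davis-Putnam elimination on an O(n) x O(n)
   matrix of clauses, O(n^4) steps in all, and n = O(|E|). *)

Require Import Defs.
From mathcomp Require Import all_boot.
From mathcomp Require Import zify.
(* ssrnat has a constructor Num too. *)
Import Defs.

Set Implicit Arguments.
Unset Strict Implicit.
Unset Printing Implicit Defensive.

(** * Programs with bounded loops *)

(* Programs whose running time and word sizes can be read off their syntax.  The
   increment PAdv r e c only happens if the new value of register r stays below
   register c: this bounds it without an argument about the program. *)
Inductive prog :=
  | PSkip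
  | PAsg of nat & expr
  | PAdv of nat & expr & nat
  | PSto of nat & expr & expr & expr
  | PSeq of prog & prog
  | PIf of expr & prog & prog
  | PFor of nat & nat & prog.

(* Registers 1 to 5 are constant after the start: they hold |V|, |E|, the row
   length 2|V| + 2 of the tables, their address, and 3.  The four tables are
   interleaved modulo 4, so that stores to different tables cannot clash. *)
Definition cell_expr (q : nat) (x y : expr) : expr :=
  Op OpAdd (Reg 4) (Op OpAdd (Op OpMul (Op OpAdd (Op OpMul x (Reg 3)) y) (Num 4))
    (Num q)).

Definition adv_test (r : nat) (e : expr) (c : nat) : expr :=
  Op OpLt (Op OpAdd (Reg r) e) (Reg c).

Definition for_test (r b : nat) : expr := Op OpLt (Reg r) (Reg b).

Definition for_step (p : cmd) (r : nat) : cmd :=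
  Seq p (Assign r (Op OpAdd (Reg r) (Num 1))).

Fixpoint compile (p : prog) : cmd :=
  match p with
  | PSkip => Skip
  | PAsg r e => Assign r e
  | PAdv r e c =>
      If (adv_test r e c) (Assign r (Op OpAdd (Reg r) e)) Skip
  | PSto q x y e => Store (cell_expr q x y) e
  | PSeq p1 p2 => Seq (compile p1) (compile p2)
  | PIf e p1 p2 => If e (compile p1) (compile p2)
  | PFor r b p1 => Seq (Assign r (Num 0))
      (While (for_test r b) (for_step (compile p1) r))
  end.

(** A loop reads its bound once, on entry, and its counter is overwritten after each round. This
    agrees with the compiled [While] because [wf] makes the bound a constant register and keeps the
    body from writing the counter. *)
Fixpoint denot (p : prog) (s : state) : state :=
  match p with
  | PSkip => s
  | PAsg r e => set_reg s r (eval s e)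
  | PAdv r e c =>
      if eval s (adv_test r e c) != 0
      then set_reg s r (regs s r + eval s e) else s
  | PSto q x y e => set_mem s (eval s (cell_expr q x y)) (eval s e)
  | PSeq p1 p2 => denot p2 (denot p1 s)
  | PIf e p1 p2 => if eval s e != 0 then denot p1 s else denot p2 s
  | PFor r b p1 =>
      iteri (regs s b) (fun i s' => set_reg (denot p1 s') r i.+1) (set_reg s r 0)
  end.

Fixpoint writes (p : prog) : seq nat :=
  match p with
  | PAsg r _ | PAdv r _ _ => [:: r]
  | PSeq p1 p2 | PIf _ p1 p2 => writes p1 ++ writes p2
  | PFor r _ p1 => r :: writes p1
  | _ => [::]
  end.

Fixpoint regions (p : prog) : seq nat :=
  match p with
  | PSto q _ _ _ => [:: q]
  | PSeq p1 p2 | PIf _ p1 p2 => regions p1 ++ regions p2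
  | PFor _ _ p1 => regions p1
  | _ => [::]
  end.

(* If all registers and memory cells hold values at most K, then e evaluates to
   at most K ^ vdeg e, and so do its subexpressions to at most K ^ deg e. *)
Fixpoint vdeg (e : expr) : nat :=
  match e with
  | Num c => c.-1
  | Reg _ | Fetch _ => 1
  | Op OpAdd a b => (maxn (vdeg a) (vdeg b)).+1
  | Op OpSub a _ => vdeg a
  | Op OpMul a b => vdeg a + vdeg b
  | Op OpEq _ _ | Op OpLt _ _ => 0
  end.

Fixpoint deg (e : expr) : nat :=
  maxn (vdeg e)
  match e with
  | Num _ | Reg _ => 0
  | Fetch a => deg a
  | Op _ a b => maxn (deg a) (deg b)
  end.

(** A common bound for the degrees in [main], checked by computation in [wf_main]. It fixes the
    exponent of the word size: with [K] the square of the input length, [K ^ 20] is the length to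
    the power 40. *)
Definition max_deg := 20.

Definition constant_reg (r : nat) : bool := 0 < r <= 5.

Definition fits_deg (e : expr) : bool := deg e <= max_deg.

(** Degree 1 keeps the stored result at most [K], so that [bounded] is an invariant; intermediate
    values may be as large as [K ^ max_deg]. *)
Definition assignable (e : expr) : bool := (vdeg e <= 1) && fits_deg e.

Fixpoint wf (p : prog) : bool :=
  match p with
  | PSkip => true
  | PAsg r e => ~~ constant_reg r && assignable e
  | PAdv r e c =>
      [&& ~~ constant_reg r, constant_reg c & fits_deg (adv_test r e c)]
  | PSto q x y e => [&& q < 4, fits_deg (cell_expr q x y) & assignable e]
  | PSeq p1 p2 => wf p1 && wf p2
  | PIf e p1 p2 => [&& fits_deg e, wf p1 & wf p2]
  | PFor r b p1 =>
      [&& ~~ constant_reg r, constant_reg b, r \notin writes p1 & wf p1]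
  end.

(** An upper bound in terms of the constant registers. A conditional pays for both branches; a loop
    pays 2 for clearing the counter, 4 for the last test, and 4 + 4 for test and increment in every
    round. *)
Fixpoint time (rho : nat -> nat) (p : prog) : nat :=
  match p with
  | PSkip => 1
  | PAsg _ e => (cost e).+1
  | PAdv r e c => (cost (adv_test r e c) + cost e).+4
  | PSto q x y e => (cost (cell_expr q x y) + cost e).+1
  | PSeq p1 p2 => time rho p1 + time rho p2
  | PIf e p1 p2 => (cost e).+1 + time rho p1 + time rho p2
  | PFor _ b p1 => 6 + rho b * (8 + time rho p1)
  end.

Lemma denot_regs p s r : r \notin writes p -> regs (denot p s) r = regs s r.
Proof.
elim: p s => //= [r' e|r' e c|p1 IH1 p2 IH2|e p1 IH1 p2 IH2|r' b p1 IH1] s.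
- by rewrite inE => /negPf ->.
- by rewrite inE; case: ifP => //= _ /negPf ->.
- by rewrite mem_cat negb_or => /andP[h1 h2]; rewrite IH2 // IH1.
- by rewrite mem_cat negb_or => /andP[h1 h2]; case: ifP => _; rewrite (IH1, IH2).
- rewrite inE negb_or => /andP[/negPf rr' h1].
  by elim: (regs s b) => [|k IH] /=; rewrite rr' // IH1.
Qed.

Lemma wf_writes p r : wf p -> constant_reg r -> r \notin writes p.
Proof.
move=> + cr; elim: p => //= [r' e|r' e c|p1 IH1 p2 IH2|e p1 IH1 p2 IH2|r' b p1 IH1].
- by case/andP=> + _; rewrite inE; apply: contra => /eqP <-.
- by case/and3P=> + _ _; rewrite inE; apply: contra => /eqP <-.
- by case/andP=> /IH1 h1 /IH2 h2; rewrite mem_cat negb_or h1.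
- by case/and3P=> _ /IH1 h1 /IH2 h2; rewrite mem_cat negb_or h1.
- case/and4P=> h _ _ /IH1 h1; rewrite inE negb_or h1 andbT.
  by apply: contra h => /eqP <-.
Qed.

Lemma denot_const p s r : wf p -> constant_reg r -> regs (denot p s) r = regs s r.
Proof. by move=> /wf_writes h /h; apply: denot_regs. Qed.

Lemma time_ext rho rho' p : wf p ->
  (forall r, constant_reg r -> rho r = rho' r) -> time rho p = time rho' p.
Proof.
move=> + h; elim: p => //= [p1 IH1 p2 IH2|e p1 IH1 p2 IH2|r' b p1 IH1].
- by case/andP=> /IH1 -> /IH2 ->.
- by case/and3P=> _ /IH1 -> /IH2 ->.
- by case/and4P=> _ cb _ /IH1 ->; rewrite h.
Qed.

(** * Compiled programs never get stuck and respect their time bound *)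

Section Execution.

Variables K W : nat.
Hypothesis K_gt1 : 1 < K.
Hypothesis KW : K ^ max_deg <= W.

Definition bounded (s : state) : Prop :=
  (forall r, regs s r <= K) /\ (forall a, mem s a <= K).

Let K_gt0 : 0 < K. Proof. exact: ltnW. Qed.

Lemma eval_vdeg s e : bounded s -> eval s e <= K ^ vdeg e.
Proof.
move=> [bR bM]; elim: e => [c|r|a IH|o a IHa b IHb] /=; rewrite ?expn1 //.
  (* A constant [c] is at most [2 ^ c.-1], hence at most [K ^ c.-1]. *)
  case: c => // c /=; elim: c => // c IH.
  rewrite expnS; apply: leq_trans (leq_mul K_gt1 IH); lia.
case: o => /=.
- rewrite expnS.
  have ha : K ^ vdeg a <= K ^ maxn (vdeg a) (vdeg b) by rewrite leq_exp2l ?leq_maxl.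
  have hb : K ^ vdeg b <= K ^ maxn (vdeg a) (vdeg b) by rewrite leq_exp2l ?leq_maxr.
  by apply: leq_trans (leq_mul K_gt1 (leqnn _)); rewrite mul2n -addnn; lia.
- by apply: leq_trans (leq_subr _ _) IHa.
- by rewrite expnD leq_mul.
- by rewrite expn0; case: eqP.
- by rewrite expn0; case: (_ < _).
Qed.

Lemma fits_degP s e : bounded s -> fits_deg e -> fits W s e.
Proof.
move=> bs; rewrite /fits_deg; elim: e => [c|r|a IH|o a IHa b IHb].
all: have h e' : vdeg e' <= max_deg -> eval s e' <= W
  by move=> h; apply: leq_trans (eval_vdeg _ bs) (leq_trans _ KW); rewrite leq_exp2l.
- by move=> d; rewrite /= (h (Num c)) // (leq_trans _ d) // leq_maxl.
- by move=> d; rewrite /= (h (Reg r)) // (leq_trans _ d) // leq_maxl.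
- rewrite -[deg _]/(maxn (vdeg (Fetch a)) (deg a)) geq_max => /andP[d /IH fa].
  by rewrite /= (h (Fetch a)).
- rewrite -[deg _]/(maxn (vdeg (Op o a b)) (maxn (deg a) (deg b))) !geq_max.
  by case/and3P=> d /IHa fa /IHb fb; rewrite /= (h (Op o a b)) // fa.
Qed.

Lemma assignableP s e : bounded s -> assignable e ->
  fits W s e /\ eval s e <= K.
Proof.
move=> bs /andP[h f]; split; first exact: fits_degP.
by apply: leq_trans (eval_vdeg _ bs) _; rewrite -[leqRHS]expn1 leq_exp2l.
Qed.

Lemma bounded_set_reg s r c : bounded s -> c <= K -> bounded (set_reg s r c).
Proof. by move=> [bR bM] h; split=> //= r'; case: ifP. Qed.

Lemma bounded_set_mem s a c : bounded s -> c <= K -> bounded (set_mem s a c).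
Proof. by move=> [bR bM] h; split=> //= r'; case: ifP. Qed.

(** Boundedness is preserved by every command, so every expression of degree at most [max_deg] fits
    in a word wherever it is evaluated. *)
Lemma exec_compile p s : wf p -> bounded s ->
  [/\ bounded (denot p s)
    & exists2 t, t <= time (regs s) p & exec W (compile p) s t (denot p s)].
Proof.
elim: p s => [|r e|r e c|q x y e|p1 IH1 p2 IH2|e p1 IH1 p2 IH2|r b p1 IH1] s.
- by split=> //; exists 1 => //; constructor.
- case/andP=> _ ae bs; have [fe ke] := assignableP bs ae.
  split; first exact: bounded_set_reg.
  by exists (cost e).+1 => //; constructor.
- move=> /= /and3P[_ _ ft] bs.
  have fT := fits_degP bs ft.
  have fA : fits W s (Op OpAdd (Reg r) e) by move: fT => /= /and3P[_ ->].
  case: ifP => [/[dup] h0|/negbT]; rewrite -?leqNgt /= => h.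
    have ltc : regs s r + eval s e < regs s c by move: h; case: ltnP.
    split; first by apply: bounded_set_reg => //; have := bs.1 c; lia.
    exists ((cost (adv_test r e c)).+1 + (cost (Op OpAdd (Reg r) e)).+1).
      by rewrite /=; lia.
    by apply: ExecIfTrue => //; constructor.
  split=> //; exists ((cost (adv_test r e c)).+1 + 1); first by rewrite /=; lia.
  apply: ExecIfFalse => //; last by constructor.
  by move: h; rewrite negbK => /eqP.
- case/and3P=> _ fa ae bs; have [fe ke] := assignableP bs ae.
  split; first exact: bounded_set_mem.
  exists (cost (cell_expr q x y) + cost e).+1 => //.
  by constructor=> //; apply: fits_degP.
- move=> /= /andP[w1 w2] bs.
  have [b1 [t1 l1 e1]] := IH1 s w1 bs.
  have [b2 [t2 l2 e2]] := IH2 _ w2 b1.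
  split=> //; exists (t1 + t2); last by apply: ExecSeq e2.
  rewrite leq_add // (leq_trans l2) // (@time_ext _ (regs s)) // => r cr.
  exact: denot_const.
- move=> /= /and3P[fe w1 w2] bs; have fW := fits_degP bs fe.
  case: ifP => he.
    have [b1 [t1 l1 e1]] := IH1 s w1 bs.
    split=> //; exists ((cost e).+1 + t1); first by lia.
    exact: ExecIfTrue.
  have [b2 [t2 l2 e2]] := IH2 s w2 bs.
  split=> //; exists ((cost e).+1 + t2); first by lia.
  by apply: ExecIfFalse => //; apply/eqP; rewrite -[_ == _]negbK he.
- move=> wfp bs; have /= /and4P[cr cb rw w1] := wfp.
  set n := regs s b.
  pose st k := iteri k (fun i s' => set_reg (denot p1 s') r i.+1) (set_reg s r 0).
  change (denot (PFor r b p1) s) with (st n).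
  have bst k : k <= n -> bounded (st k).
    elim: k => [|k IH] lek; first exact: bounded_set_reg.
    apply: bounded_set_reg; first by have [] := IH1 (st k) w1 (IH (ltnW lek)).
    by apply: leq_trans lek (bs.1 b).
  have rst k : regs (st k) r = k by case: k => [|k] /=; rewrite eqxx.
  have cst k r' : constant_reg r' -> regs (st k) r' = regs s r'.
    move=> cr'; have rr' : (r' == r) = false by apply: contraNF cr => /eqP <-.
    by elim: k => [|k IH] /=; rewrite rr' // denot_const.
  split; first exact: bst.
  (* Induction on the number [k] of rounds still to run, starting from the state after [n - k]
     rounds. *)
  suff loop k : k <= n -> exists2 t, t <= 4 + k * (8 + time (regs s) p1) &
      exec W (While (for_test r b) (for_step (compile p1) r)) (st (n - k)) t (st n).
    have [t lt et] := loop n (leqnn _); rewrite subnn in et.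
    exists (2 + t); first by rewrite /= -/n; lia.
    apply: ExecSeq et; exact: (@ExecAssign W s r (Num 0)).
  have test k' : k' <= n -> fits W (st k') (for_test r b).
    by move=> lek; apply: fits_degP => //; apply: bst.
  elim: k => [|k IH] lek.
    exists 4 => //; rewrite subn0; apply: ExecWhileFalse; first exact: test.
    by rewrite /= rst cst // -/n ltnn.
  have [t lt et] := IH (ltnW lek).
  have lek' : n - k.+1 <= n by lia.
  have [b1 [t1 l1 e1]] := IH1 (st (n - k.+1)) w1 (bst _ lek').
  exists (4 + (t1 + 4) + t).
    have eqT : time (regs (st (n - k.+1))) p1 = time (regs s) p1.
      by apply: time_ext => // r' /cst.
    by rewrite mulSn; rewrite eqT in l1; lia.
  apply: ExecWhileTrue et; first exact: test.
    by rewrite /= rst cst // -/n; lia.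
  apply: ExecSeq e1 _.
  have -> : st (n - k) = set_reg (denot p1 (st (n - k.+1))) r
      (eval (denot p1 (st (n - k.+1))) (Op OpAdd (Reg r) (Num 1))).
    have -> : n - k = (n - k.+1).+1 by lia.
    by rewrite /= denot_regs // rst addn1.
  by apply: ExecAssign; apply: fits_degP.
Qed.

End Execution.

(** * The program *)

Definition Get (q : nat) (x y : expr) : expr := Fetch (cell_expr q x y).
Definition EEq (a b : expr) : expr := Op OpEq a b.
Definition ELt (a b : expr) : expr := Op OpLt a b.
Definition ENot (a : expr) : expr := Op OpEq a (Num 0).
Definition EAnd (a b : expr) : expr := Op OpMul a b.
Definition EOr (a b : expr) : expr := ENot (EAnd (ENot a) (ENot b)).
Definition EMem (x e : expr) : expr :=
  EOr (EEq x (Get 0 e (Num 0))) (EOr (EEq x (Get 0 e (Num 1))) (EEq x (Get 0 e (Num 2)))).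

(* Table 0 receives the hyperedges, padded to three slots with the non-vertex |V|. *)
Definition parse : prog :=
  PSeq (PAsg 6 (Num 2))
    (PFor 7 2 (PSeq
      (PFor 8 5
        (PIf (ELt (Reg 8) (Fetch (Reg 6)))
          (PSto 0 (Reg 7) (Reg 8)
            (Fetch (Op OpAdd (Op OpAdd (Reg 6) (Num 1)) (Reg 8))))
          (PSto 0 (Reg 7) (Reg 8) (Reg 1))))
      (PAdv 6 (Op OpAdd (Num 1) (Fetch (Reg 6))) 4))).

(** Registers 7 and 8 index the hyperedges e and f of the adjacency criterion, 11 a hyperedge that
    may spoil it, 12 and 13 hold u and w. Padding counts as covered. *)
Definition covered_expr (x : expr) : expr :=
  EOr (EEq x (Reg 1)) (EOr (EMem x (Reg 7)) (EMem x (Reg 8))).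

Definition block_expr : expr :=
  EAnd (ENot (EOr (EMem (Reg 12) (Reg 11)) (EMem (Reg 13) (Reg 11))))
    (EAnd (covered_expr (Get 0 (Reg 11) (Num 0)))
      (EAnd (covered_expr (Get 0 (Reg 11) (Num 1)))
        (covered_expr (Get 0 (Reg 11) (Num 2))))).

(** The two comparisons with [|V|] rule out padding slots. *)
Definition private_expr : expr :=
  EAnd (EAnd (ELt (Reg 12) (Reg 1)) (ELt (Reg 13) (Reg 1)))
    (EOr (EEq (Reg 12) (Reg 13))
      (ENot (EOr (EMem (Reg 13) (Reg 7)) (EMem (Reg 12) (Reg 8))))).

(* Register 14 is set when the pair of hyperedges does not witness that the
   vertices in registers 12 and 13 are adjacent; table 1 is the adjacency matrix. *)
Definition adj_block : prog := PIf block_expr (PAsg 14 (Num 1)) PSkip.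

Definition adj_body : prog :=
  PSeq (PAsg 12 (Get 0 (Reg 7) (Reg 9)))
  (PSeq (PAsg 13 (Get 0 (Reg 8) (Reg 10)))
  (PSeq (PAsg 14 (ENot private_expr))
  (PSeq (PFor 11 2 adj_block)
  (PIf (Reg 14) PSkip (PSto 1 (Reg 12) (Reg 13) (Num 1)))))).

Definition adjacency : prog :=
  PFor 7 2 (PFor 8 2 (PFor 9 5 (PFor 10 5 adj_body))).

(** Row [|V|] of table 1 stays zero, so a padding slot is missed by any vertex and hyperedges with
    fewer than three vertices need no special treatment. *)
Definition missed_expr : expr :=
  EAnd (EAnd (Get 1 (Reg 8) (Reg 9)) (EAnd (Get 1 (Reg 8) (Reg 10)) (Get 1 (Reg 9) (Reg 10))))
    (EAnd (ENot (Get 1 (Get 0 (Reg 7) (Num 0)) (Reg 8)))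
    (EAnd (ENot (Get 1 (Get 0 (Reg 7) (Num 1)) (Reg 9)))
      (ENot (Get 1 (Get 0 (Reg 7) (Num 2)) (Reg 10))))).

Definition missed_body : prog := PIf missed_expr (PAsg 0 (Num 1)) PSkip.

Definition missed : prog :=
  PFor 7 2 (PFor 8 1 (PFor 9 1 (PFor 10 1 missed_body))).

Definition fill (q : nat) (e : expr) : prog :=
  PFor 8 3 (PFor 9 3 (PSto q (Reg 8) (Reg 9) e)).

Definition neg_expr (x : expr) : expr := Op OpAdd (Op OpAdd x (Reg 1)) (Num 1).
Definition unneg_expr (x : expr) : expr := Op OpSub (Op OpSub x (Reg 1)) (Num 1).

(* Tables 2 and 3 hold clause matrices; see [value] below for the literals. *)
Definition clause_expr : expr :=
  EOr (EAnd (EAnd (ELt (Reg 1) (Reg 8)) (ELt (Reg 1) (Reg 9)))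
    (ENot (Get 1 (unneg_expr (Reg 8)) (unneg_expr (Reg 9)))))
  (EOr (EAnd (EEq (Reg 8) (Reg 7)) (EEq (Reg 9) (Reg 1)))
    (EAnd (EEq (Reg 8) (Reg 1)) (EEq (Reg 9) (Reg 7)))).

(** If slot [i] holds v, one of the other two slots must hold a clique vertex. A padding slot is the
    literal false, so small hyperedges yield unit or empty clauses. Both orders are stored to keep
    the matrix symmetric. *)
Definition link_clause (i j k : nat) : prog :=
  PIf (EEq (Get 0 (Reg 11) (Num i)) (Reg 7))
    (PSeq (PSto 2 (Get 0 (Reg 11) (Num j)) (Get 0 (Reg 11) (Num k)) (Num 1))
      (PSto 2 (Get 0 (Reg 11) (Num k)) (Get 0 (Reg 11) (Num j)) (Num 1)))
    PSkip.

Definition link_body : prog :=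
  PSeq (link_clause 0 1 2) (PSeq (link_clause 1 0 2) (link_clause 2 0 1)).

Definition half_expr (k l : expr) : expr :=
  EOr (Get 2 k l) (EAnd (EEq l (Reg 1)) (Get 2 k k)).

Definition resolve_expr : expr :=
  EOr (Get 2 (Reg 8) (Reg 9))
  (EOr (EAnd (half_expr (Reg 10) (Reg 8)) (half_expr (neg_expr (Reg 10)) (Reg 9)))
    (EAnd (half_expr (Reg 10) (Reg 9)) (half_expr (neg_expr (Reg 10)) (Reg 8)))).

Definition resolve : prog :=
  PSeq (fill 3 resolve_expr) (fill 2 (Get 3 (Reg 8) (Reg 9))).

(** The diagonal entry at [|V|] is the empty clause, false \/ false. A vertex not adjacent to itself
    is also reported here. *)
Definition verdict_expr : expr :=
  EOr (ENot (Get 2 (Reg 1) (Reg 1))) (ENot (Get 1 (Reg 7) (Reg 7))).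

Definition redundant_body : prog :=
  PSeq (fill 2 clause_expr)
  (PSeq (PFor 11 2 link_body)
  (PSeq (PFor 10 1 resolve)
    (PIf verdict_expr (PAsg 0 (Num 1)) PSkip))).

Definition redundant : prog := PFor 7 1 redundant_body.

Definition main : prog :=
  PSeq parse (PSeq adjacency (PSeq missed (PSeq redundant (PAsg 0 (ENot (Reg 0)))))).

Lemma wf_main : wf main. Proof. by vm_compute. Qed.

(** * Conformality of the dual hypergraph *)

Section DualConformality.

Variables (V : finType) (E : {set {set V}}).

Lemma transversalP (T : {set V}) :
  reflect (forall e, e \in E -> exists2 x, x \in T & x \in e) (transversal E T).
Proof.
apply: (iffP forall_inP) => h e /h.
  by case/set0Pn => x; rewrite inE => /andP[]; exists x.
by case=> x xT xe; apply/set0Pn; exists x; rewrite inE xT.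
Qed.

Lemma dual_transversal T : T \in dual E -> transversal E T.
Proof. by rewrite inE => /minsetp. Qed.

(** By minimality [T :\ u] misses some hyperedge, which [T] can then meet only in [u]. *)
Lemma dual_private T u : T \in dual E -> u \in T ->
  exists2 e, e \in E & forall x, x \in T -> x \in e = (x == u).
Proof.
move=> dT uT; have /minsetP[tT minT] : minset (transversal E) T by move: dT; rewrite inE.
have : ~~ transversal E (T :\ u).
  apply/negP => /minT/(_ (subD1set _ _)) eqT.
  by move: uT; rewrite -eqT !inE eqxx.
rewrite negb_forall_in => /exists_inP[e eE]; rewrite negbK => /eqP Te0.
exists e => // x xT; have [y yT ye] := transversalP _ tT e eE.
have out z : z \in T -> z \in e -> z = u.
  move=> zT ze; apply/eqP; apply: contraT => zu.
  have : z \in (T :\ u) :&: e by rewrite !inE zu zT.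
  by rewrite Te0 inE.
apply/idP/eqP => [/(out x xT) //|->]; by rewrite -(out y yT ye).
Qed.

Lemma dual_below X : transversal E X -> exists2 T, T \in dual E & T \subset X.
Proof. by case/minset_exists => T minT TX; exists T; rewrite // inE. Qed.

Definition codual (u w : V) : bool := [exists T in dual E, (u \in T) && (w \in T)].

Definition separated (u w : V) (e f : {set V}) : bool :=
  [&& u \in e, w \in f, (u == w) || (w \notin e) && (u \notin f)
    & [forall g in E, [|| u \in g, w \in g | ~~ (g \subset e :|: f)]]].

Lemma codualC u w : codual u w = codual w u.
Proof. by apply: eq_existsb => T; rewrite [(u \in T) && _]andbC. Qed.

(** From left to right, e and f are private hyperedges of u and w in a common minimal transversal; a
    hyperedge avoiding u and w is hit by a third vertex, which lies outside both. *)
Lemma codualP u w :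
  reflect (exists e f, [/\ e \in E, f \in E & separated u w e f]) (codual u w).
Proof.
apply: (iffP exists_inP) => [[T dT /andP[uT wT]]|[e [f [eE fE /and4P[ue wf uw /forall_inP sep]]]]].
  have [e eE pe] := dual_private dT uT; have [f fE pf] := dual_private dT wT.
  exists e, f; split=> //; rewrite /separated pe // eqxx pf // eqxx /=.
  rewrite pe // pf // [w == u]eq_sym andbb orbN /=.
  apply/forall_inP => g gE; have [x xT xg] := transversalP _ (dual_transversal dT) g gE.
  case: (eqVneq x u) => [<-|xu]; first by rewrite xg.
  case: (eqVneq x w) => [<-|xw]; first by rewrite xg orbT.
  apply/or3P/Or33/negP => /subsetP/(_ x xg).
  by rewrite inE pe // pf // (negPf xu) (negPf xw).
pose X := [set u; w] :|: ~: (e :|: f).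
have : transversal E X.
  apply/transversalP => g gE; case/or3P: (sep g gE) => [ug|wg|].
  - by exists u; rewrite // !inE eqxx.
  - by exists w; rewrite // !inE eqxx orbT.
  - by case/subsetPn => x xg nx; exists x; rewrite // !inE; move: nx; rewrite !inE => ->; rewrite !orbT.
case/dual_below => T dT /subsetP TX; exists T => //.
(* Within [e :|: f] the set [X] has only u and w, so [T] hits e in one of them; w lies in e only
   when [u == w]. The same holds for f with u and w exchanged. *)
have tT := transversalP _ (dual_transversal dT).
apply/andP; split.
  have [x xT xe] := tT e eE; move: (TX x xT); rewrite !inE xe /= orbF.
  case/orP => /eqP xx; subst x => //.
  by case/orP: uw => [/eqP -> //|]; rewrite xe.
have [x xT xf] := tT f fE; move: (TX x xT); rewrite !inE xf orbT /= orbF.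
case/orP => /eqP xx; subst x => //.
by case/orP: uw => [/eqP <- //|]; rewrite xf andbF.
Qed.

Definition is_clique (U : {set V}) : bool :=
  [forall x in U, forall y in U, codual x y].

Lemma is_cliqueP (U : {set V}) : reflect {in U &, forall x y, codual x y} (is_clique U).
Proof.
apply: (iffP forall_inP) => h x => [y /h/forall_inP h' /h' //|xU].
by apply/forall_inP => y; apply: h.
Qed.

Lemma dual_clique T : T \in dual E -> is_clique T.
Proof.
by move=> dT; apply/is_cliqueP => x y xT yT; apply/exists_inP; exists T; rewrite ?xT.
Qed.

(** The member [v] of [C] has no private hyperedge in the sense of [dual_private]. *)
Definition redundant_in (C : {set V}) (v : V) : bool :=
  (v \in C) && [forall e in E, (v \in e) ==> [exists x in C, (x \in e) && (x != v)]].

Definition blocks_edge (C e : {set V}) : bool :=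
  [forall x in e, exists y in C, ~~ codual x y].

(** Under the three conditions every maximal clique is a minimal transversal: the second makes it a
    transversal, the third makes it minimal. Conversely, conformality puts any clique inside a
    minimal transversal, which meets every hyperedge and has private hyperedges. *)
Lemma conformal_dualP :
  reflect [/\ forall v, codual v v,
              forall C e, is_clique C -> e \in E -> ~~ blocks_edge C e
            & forall C v, is_clique C -> ~~ redundant_in C v]
    (conformal (dual E)).
Proof.
apply: (iffP idP) => [conf|[loops cover irr]].
  have sub (U : {set V}) : {in U &, forall x y, x != y -> codual x y} ->
      exists2 T, T \in dual E & U \subset T.
    move=> cU; apply/exists_inP; move/forallP/(_ U)/implyP: conf; apply.
    by apply/forall_inP => x xU; apply/forall_inP => y yU; apply/implyP; apply: cU.
  have subC C : is_clique C -> exists2 T, T \in dual E & C \subset T.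
    by move/is_cliqueP => cC; apply: sub => x y xC yC _; apply: cC.
  split=> [v|C e cC eE|C v cC].
  (* A singleton has no pair of distinct vertices, so conformality alone places [v] in a minimal
     transversal. *)
  - have [|T dT] := sub [set v].
      by move=> x y /set1P -> /set1P ->; rewrite eqxx.
    by rewrite sub1set => vT; apply/exists_inP; exists T; rewrite ?vT.
  - apply/negP => /forall_inP miss; have [T dT /subsetP CT] := subC C cC.
    have [x xT /miss /exists_inP[y /CT yT]] := transversalP _ (dual_transversal dT) e eE.
    by rewrite (is_cliqueP _ (dual_clique dT)).
  - apply/negP => /andP[vC /forall_inP red]; have [T dT /subsetP CT] := subC C cC.
    have [e eE pe] := dual_private dT (CT v vC).
    move/(_ e eE): red; rewrite pe ?CT // eqxx => /exists_inP[x /CT xT].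
    by rewrite pe // andbN.
apply/forallP => U; apply/implyP => /forall_inP clU.
have cU : is_clique U.
  apply/is_cliqueP => x y xU yU; case: (eqVneq x y) => [<-|xy]; first exact: loops.
  by move/forall_inP/(_ y yU)/implyP: (clU x xU); apply.
have [C /maxsetP[cC maxC] UC] := maxset_exists cU.
suff dC : C \in dual E by apply/exists_inP; exists C.
have tC : transversal E C.
  apply/transversalP => e eE; move: (cover C e cC eE).
  rewrite negb_forall_in => /exists_inP[x xe]; rewrite negb_exists_in => /forall_inP adj.
  (* The vertex [x] of [e] is adjacent to all of [C], so maximality forces it into [C]. *)
  exists x => //; suff <- : x |: C = C by rewrite !inE eqxx.
  apply: maxC; last exact: subsetUr.
  have adjx y : y \in C -> codual x y by move/adj; rewrite negbK.
  apply/is_cliqueP => y z; rewrite !inE => /orP[/eqP->|yC] /orP[/eqP->|zC] //.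
  - exact: adjx.
  - by rewrite codualC adjx.
  - exact: (is_cliqueP _ cC).
(* Each [v] in [C] has a hyperedge meeting [C] in [v] alone; [T] hits it inside [C], hence contains
   [v]. *)
have [T dT TC] := dual_below tC.
suff <- : T = C by [].
apply/eqP; rewrite eqEsubset TC; apply/subsetP => v vC.
move: (irr C v cC); rewrite negb_and vC /= negb_forall_in => /exists_inP[e eE].
rewrite negb_imply negb_exists_in => /andP[ve /forall_inP priv].
have [x xT xe] := transversalP _ (dual_transversal dT) e eE.
have := priv x (subsetP TC x xT); rewrite xe /= negbK => /eqP <- //.
Qed.

End DualConformality.

(** * Resolution for 2-CNF formulas *)

Section Resolution.

Variable n : nat.

(* Literals are numbers below n.*2.+2: u < n is a variable, n is the constant
   false, and u + n + 1 is the negation of u.  A 2-CNF is a symmetric relation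
   on literals: M l l' says that it contains the clause l \/ l'. *)
Definition var (l : nat) : nat := if l <= n then l else l - n.+1.

Definition atom_value (sigma : nat -> bool) (u : nat) : bool := (u < n) && sigma u.

Definition value (sigma : nat -> bool) (l : nat) : bool :=
  if l <= n then atom_value sigma l else ~~ atom_value sigma (l - n.+1).

(** The level [k] stands for the elimination of the variables below [k]: clauses mentioning them are
    ignored. The constants have [var] equal to [n] and are never ignored. *)
Definition satisfied (M : nat -> nat -> bool) (k : nat) (sigma : nat -> bool) :=
  forall l l', l < n.*2.+2 -> l' < n.*2.+2 -> k <= var l -> k <= var l' ->
    M l l' -> value sigma l || value sigma l'.

(* A clause k \/ k counts as k \/ false. *)
Definition half_clause (M : nat -> nat -> bool) (k l : nat) : bool :=
  M k l || (l == n) && M k k.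

(** A Davis-Putnam step that adds all resolvents on [k] and deletes nothing; the old clauses on [k]
    drop out through the level in [satisfied]. *)
Definition resolved (k : nat) (M : nat -> nat -> bool) (l l' : nat) : bool :=
  [|| M l l', half_clause M k l && half_clause M (k + n + 1) l'
    | half_clause M k l' && half_clause M (k + n + 1) l].

Lemma value_neg sigma k : k <= n -> value sigma (k + n + 1) = ~~ value sigma k.
Proof.
by move=> kn; rewrite /value kn ifN; [congr (~~ atom_value _ _); lia|lia].
Qed.

Lemma value_false sigma : value sigma n = false.
Proof. by rewrite /value leqnn /atom_value ltnn. Qed.

Lemma resolved_sym k M : symmetric M -> symmetric (resolved k M).
Proof. by move=> sM l l'; rewrite /resolved sM; congr orb; rewrite orbC. Qed.

Lemma half_sound M sigma k l : satisfied M 0 sigma -> k < n.*2.+2 -> l < n.*2.+2 ->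
  half_clause M k l -> value sigma k || value sigma l.
Proof.
move=> sat kL lL /orP[|/andP[/eqP ->]]; first exact: sat.
by move=> h; have := sat _ _ kL kL isT isT h; rewrite orbb => ->.
Qed.

Lemma resolved_sound M sigma k : k < n ->
  satisfied M 0 sigma -> satisfied (resolved k M) 0 sigma.
Proof.
move=> kn sat l l' lL l'L _ _ /or3P[|/andP[a b]|/andP[a b]]; first exact: sat.
all: have kL : k < n.*2.+2 by lia.
all: have k'L : k + n + 1 < n.*2.+2 by lia.
- have := half_sound sat kL lL a; have := half_sound sat k'L l'L b.
  by rewrite value_neg ?(ltnW kn) //; case: (value sigma k) => /= [-> _|_ ->]; rewrite ?orbT.
- have := half_sound sat kL l'L a; have := half_sound sat k'L lL b.
  by rewrite value_neg ?(ltnW kn) //; case: (value sigma k) => /= [-> _|_ ->]; rewrite ?orbT.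
Qed.

(** The variable [k] is made true exactly when some clause k \/ l with l false needs it. If a clause
    (not k) \/ l' then failed, the resolvent l \/ l' would be violated already. *)
Lemma resolved_complete M sigma k : k < n -> symmetric M ->
  satisfied (resolved k M) k.+1 sigma -> exists sigma', satisfied M k sigma'.
Proof.
move=> kn symM sat.
pose need := has (fun l => [&& k < var l, half_clause M k l & ~~ value sigma l]) (iota 0 n.*2.+2).
pose sigma' u := if u == k then need else sigma u.
have keep l : k < var l -> value sigma' l = value sigma l.
  rewrite /value /var /atom_value /sigma'; case: ifP => _ kl.
    by have -> : l == k = false by lia.
  by have -> : l - n.+1 == k = false by lia.
have vk : value sigma' k = need by rewrite /value (ltnW kn) /atom_value kn /sigma' eqxx.
have vnk : value sigma' (k + n + 1) = ~~ need by rewrite value_neg ?vk // ltnW.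
have lits l : l < n.*2.+2 -> k <= var l -> [\/ k < var l, l = k | l = k + n + 1].
  rewrite /var; case: ifP => h lL kl.
    by case: (eqVneq l k) => [->|lk]; [constructor 2|constructor 1; lia].
  case: (eqVneq l (k + n + 1)) => [->|lk]; [by constructor 3|constructor 1; lia].
have nL : n < n.*2.+2 by lia.
have kvn : k < var n by rewrite /var leqnn.
have pos l : l < n.*2.+2 -> k < var l -> half_clause M k l -> value sigma' k || value sigma' l.
  move=> lL kl hl; rewrite vk keep //; case vl: (value sigma l); rewrite ?orbT // orbF.
  by apply/hasP; exists l; rewrite ?mem_iota // kl hl vl.
have neg l : l < n.*2.+2 -> k < var l -> half_clause M (k + n + 1) l ->
    value sigma' (k + n + 1) || value sigma' l.
  move=> lL kl hl; rewrite vnk keep //; case vl: (value sigma l); rewrite ?orbT // orbF.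
  apply/negP => /hasP[l0]; rewrite mem_iota => /andP[_ l0L] /and3P[k0 h0 /negPf v0].
  by have := sat l0 l l0L lL k0 kl; rewrite /resolved h0 hl v0 vl orbT => /(_ isT).
have hM a l : M a l -> half_clause M a l by rewrite /half_clause => ->.
have hU a : M a a -> half_clause M a n by rewrite /half_clause => ->; rewrite eqxx orbT.
have vn := value_false sigma'.
exists sigma' => l l' lL l'L kl kl' Mll'.
have Ml'l : M l' l by rewrite symM.
(* Nine cases: each literal lies above [k], is [k], or is its negation. A clause on twice the same
   literal is read with false in second place, and k \/ not k is a tautology. *)
case: (lits l lL kl) => el; case: (lits l' l'L kl') => el'.
- rewrite !keep //; apply: sat => //; by rewrite /resolved Mll'.
- by rewrite orbC; subst l'; apply: pos => //; apply: hM.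
- by rewrite orbC; subst l'; apply: neg => //; apply: hM.
- by subst l; apply: pos => //; apply: hM.
- by subst l l'; have := pos n nL kvn (hU _ Mll'); rewrite vn orbF => ->.
- by subst l l'; rewrite vk vnk orbN.
- by subst l; apply: neg => //; apply: hM.
- by subst l l'; rewrite vk vnk orNb.
- by subst l l'; have := neg n nL kvn (hU _ Mll'); rewrite vn orbF => ->.
Qed.

(** An assignment of [M] satisfies all resolvents, so the empty clause never appears. Conversely, an
    assignment for the last level is carried back one variable at a time by [resolved_complete]. *)
Lemma eliminationP M : symmetric M ->
  reflect (exists sigma, satisfied M 0 sigma) (~~ iteri n resolved M n n).
Proof.
move=> symM; have nL : n < n.*2.+2 by lia.
have symk k : symmetric (iteri k resolved M).
  by elim: k => //= k; apply: resolved_sym.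
apply: (iffP idP) => [empty|[sigma sat]].
  suff down k : k <= n -> exists sigma, satisfied (iteri (n - k) resolved M) (n - k) sigma.
    by have := down n (leqnn n); rewrite subnn.
  elim: k => [_|k IH kn].
    (* At level [n] only the constants false and true are left, and false \/ false is the only
       clause that could fail. *)
    exists xpred0; rewrite subn0 => l l' lL l'L vl vl' Mll'.
    have litn x : x < n.*2.+2 -> n <= var x -> x = n \/ value xpred0 x.
      rewrite /var /value /atom_value !andbF; case: ifP => h xL; last by right.
      by left; lia.
    case: (litn l lL vl) => [e|-> //]; case: (litn l' l'L vl') => [e'|->]; rewrite ?orbT //.
    by rewrite e e' (negPf empty) in Mll'.
  have [sigma] := IH (ltnW kn); rewrite -(subnSK kn).
  apply: (resolved_complete _ (symk _)); lia.
apply/negP => bad.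
have up k : k <= n -> satisfied (iteri k resolved M) 0 sigma.
  by elim: k => //= k IH kn; apply: resolved_sound; [exact: kn|apply: IH; apply: ltnW].
by have := up n (leqnn n) n n nL nL isT isT bad; rewrite value_false.
Qed.

End Resolution.

(** * The decision procedure on labels *)

Definition some_below (k : nat) (P : nat -> bool) : bool := has P (iota 0 k).

Lemma some_belowP k (P : nat -> bool) : reflect (exists2 i, i < k & P i) (some_below k P).
Proof.
apply: (iffP hasP) => [[i]|[i ik Pi]]; first by rewrite mem_iota; exists i.
by exists i; rewrite ?mem_iota.
Qed.

Lemma eq_some_below k (P Q : nat -> bool) :
  (forall i, i < k -> P i = Q i) -> some_below k P = some_below k Q.
Proof. by move=> PQ; apply: eq_in_has => i; rewrite mem_iota => /PQ. Qed.

Lemma neg_lt a b : a <= b -> a + b + 1 < b.*2.+2.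
Proof. lia. Qed.

Lemma unnegK a b : a + b + 1 - b - 1 = a.
Proof. lia. Qed.

Section Decision.

Variables (n m : nat) (t : nat -> nat -> nat).

Definition slot_mem (x e : nat) : bool := [|| x == t e 0, x == t e 1 | x == t e 2].

Definition covered (e f x : nat) : bool := [|| x == n, slot_mem x e | slot_mem x f].

Definition blocking (e f u w g : nat) : bool :=
  [&& ~~ (slot_mem u g || slot_mem w g), covered e f (t g 0), covered e f (t g 1)
    & covered e f (t g 2)].

Definition private (e f u w : nat) : bool :=
  ((u < n) && (w < n)) && ((u == w) || ~~ (slot_mem w e || slot_mem u f)).

Definition codual_slot (x y e f i j : nat) : bool :=
  [&& private e f (t e i) (t f j), ~~ some_below m (blocking e f (t e i) (t f j)),
    x == t e i & y == t f j].

Definition codual_index (x y : nat) : bool :=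
  some_below m (fun e => some_below m (fun f =>
    some_below 3 (fun i => some_below 3 (codual_slot x y e f i)))).

Definition misses (e x y z : nat) : bool :=
  [&& codual_index x y, codual_index x z & codual_index y z] &&
  [&& ~~ codual_index (t e 0) x, ~~ codual_index (t e 1) y & ~~ codual_index (t e 2) z].

Definition missed_index : bool :=
  some_below m (fun e => some_below n (fun x => some_below n (fun y =>
    some_below n (misses e x y)))).

Definition link_index (v l l' e : nat) (s : nat * nat * nat) : bool :=
  (t e s.1.1 == v) && ((l == t e s.1.2) && (l' == t e s.2)
    || (l == t e s.2) && (l' == t e s.1.2)).

Definition links (v l l' e : nat) : bool :=
  [|| link_index v l l' e (0, 1, 2), link_index v l l' e (1, 0, 2)
    | link_index v l l' e (2, 0, 1)].

(* The 2-CNF whose models are the cliques containing v in which v is redundant. *)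
Definition clauses (v l l' : nat) : bool :=
  [|| ((n < l) && (n < l')) && ~~ codual_index (l - n - 1) (l' - n - 1),
    (l == v) && (l' == n) | (l == n) && (l' == v)]
  || some_below m (links v l l').

(** The condition that every vertex is adjacent to itself is tested in the same pass. *)
Definition redundant_index : bool :=
  some_below n (fun v => ~~ iteri n (resolved n) (clauses v) n n || ~~ codual_index v v).

End Decision.

(** * The tests on labels decide conformality of the dual *)

Section Correctness.

Variables (V : finType) (E : {set {set V}}) (label : V -> 'I_#|V|).
Variables (m : nat) (edge : nat -> {set V}) (t : nat -> nat -> nat).
Hypothesis V_gt0 : 0 < #|V|.
Hypothesis label_inj : injective label.
Hypothesis edgeE : forall e, reflect (exists2 i, i < m & e = edge i) (e \in E).
Hypothesis slot_memE : forall i v, i < m -> slot_mem t (label v) i = (v \in edge i).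
Hypothesis slotE : forall i j, i < m -> j < 3 ->
  t i j = #|V| \/ exists v, t i j = label v.
Hypothesis slot_inj : forall i j k, i < m -> j < 3 -> k < 3 -> j != k ->
  t i j = t i k -> t i j = #|V|.

Local Notation n := #|V|.
Local Notation codualn := (codual_index n m t).

Let edgeI i : i < m -> edge i \in E. Proof. by move=> im; apply/edgeE; exists i. Qed.

Lemma label_eq (u w : V) : (label u == label w :> nat) = (u == w).
Proof. by rewrite (inj_eq val_inj) (inj_eq label_inj). Qed.

Lemma label_lt (u : V) : label u < n.
Proof. exact: ltn_ord. Qed.

Lemma label_onto x : x < n -> exists v, x = label v.
Proof.
have [g _ gK] : bijective label by apply: inj_card_bij; rewrite // card_ord.
by move=> xn; exists (g (Ordinal xn)); rewrite gK.
Qed.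

Lemma slot_exists i v : i < m -> v \in edge i -> exists2 j, j < 3 & t i j = label v.
Proof.
by move=> im; rewrite -slot_memE // => /or3P[] /eqP ->; [exists 0|exists 1|exists 2].
Qed.

Lemma slot_in i j v : i < m -> j < 3 -> t i j = label v -> v \in edge i.
Proof.
move=> im j3 tij; rewrite -slot_memE // -tij.
by case: j j3 {tij} => [|[|[|j]]] // _; rewrite /slot_mem eqxx ?orbT.
Qed.

Lemma slot_le i j : i < m -> j < 3 -> t i j <= n.
Proof. by move=> im /(slotE im)[-> //|[v ->]]; rewrite ltnW // label_lt. Qed.

(** Padding counts as covered, so three covered slots mean exactly that the hyperedge lies in the
    union of the other two. *)
Lemma blockingE e f u w g : e < m -> f < m -> g < m ->
  blocking n t e f (label u) (label w) g
  = ~~ [|| u \in edge g, w \in edge g | ~~ (edge g \subset edge e :|: edge f)].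
Proof.
move=> em fm gm; rewrite /blocking !slot_memE // !negb_or negbK -andbA.
congr [&& _, _ & _]; apply/and3P/subsetP => [[c0 c1 c2] x xg|sub].
  have [j j3 tj] := slot_exists gm xg.
  have : covered n t e f (t g j) by case: j j3 {tj} => [|[|[|j]]].
  by rewrite tj /covered !slot_memE // inE (ltn_eqF (label_lt x)).
have cov j : j < 3 -> covered n t e f (t g j).
  move=> j3; case: (slotE gm j3) => [->|[v tv]]; rewrite /covered ?eqxx //.
  have := sub v (slot_in gm j3 tv).
  by rewrite tv !slot_memE // inE => ->; rewrite orbT.
by split; apply: cov.
Qed.

Lemma codual_indexE u w : codualn (label u) (label w) = codual E u w.
Proof.
apply/idP/codualP => [|[_ [_ [/edgeE[e em ->] /edgeE[f fm ->]]]]].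
  case/some_belowP => e em /some_belowP[f fm] /some_belowP[i i3] /some_belowP[j j3].
  case/and4P => pr nb /eqP tu /eqP tw; exists (edge e), (edge f).
  split; [exact: edgeI|exact: edgeI|].
  move: pr nb; rewrite -tu -tw /private !label_lt label_eq !slot_memE // negb_or !andTb => pr nb.
  rewrite /separated (slot_in em i3) // (slot_in fm j3) // pr /=.
  apply/forall_inP => _ /edgeE[g gm ->]; rewrite -[X in is_true X]negbK -blockingE //.
  by apply: contra nb => bg; apply/some_belowP; exists g.
case/and4P => ue wf uw /forall_inP sep.
have [i i3 ti] := slot_exists em ue; have [j j3 tj] := slot_exists fm wf.
apply/some_belowP; exists e => //; apply/some_belowP; exists f => //.
apply/some_belowP; exists i => //; apply/some_belowP; exists j => //.
rewrite /codual_slot ti tj !eqxx !andbT /private !label_lt label_eq !slot_memE //.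
rewrite negb_or uw /=; apply/negP => /some_belowP[g gm].
by rewrite blockingE // sep // edgeI.
Qed.

(** In particular the padding value is adjacent to nothing. *)
Lemma codual_index_lt x y : codualn x y -> (x < n) && (y < n).
Proof.
case/some_belowP => e em /some_belowP[f fm] /some_belowP[i i3] /some_belowP[j j3].
by case/and4P => /andP[h _] _ /eqP -> /eqP ->.
Qed.

Lemma codual_index_sym : symmetric codualn.
Proof.
move=> x y; case xy: ((x < n) && (y < n)).
  by case/andP: xy => /label_onto[u ->] /label_onto[w ->]; rewrite !codual_indexE codualC.
have yx : (y < n) && (x < n) = false by rewrite andbC.
by apply/idP/idP => /codual_index_lt; rewrite (xy, yx).
Qed.

(** One non-neighbour in the clique per slot is enough, so a blocking clique shrinks to at most
    three vertices. *)
Lemma missed_indexP : (forall v, codual E v v) ->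
  reflect (exists C e, [/\ is_clique E C, e \in E & blocks_edge E C e])
    (missed_index n m t).
Proof.
move=> loops; apply: (iffP idP) => [/some_belowP[e em]|].
  case/some_belowP => _ /label_onto[x ->] /some_belowP[_ /label_onto[y ->]].
  case/some_belowP => _ /label_onto[z ->]; rewrite /misses !codual_indexE.
  case/andP => /and3P[xy xz yz] /and3P[mx my mz].
  exists [set x; y; z], (edge e); split; last 1 first.
  - apply/forall_inP => v /(slot_exists em)[j j3 tj]; apply/exists_inP.
    case: j j3 tj => [|[|[|j]]] // _ tj; move: mx my mz; rewrite tj !codual_indexE.
    + by exists x; rewrite // !inE eqxx.
    + by exists y; rewrite // !inE eqxx orbT.
    + by exists z; rewrite // !inE eqxx orbT.
  - apply/is_cliqueP => a b; rewrite !inE.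
    by case/orP => [/orP[]|] /eqP -> /orP[/orP[]|] /eqP -> //; rewrite codualC.
  - exact: edgeI.
case=> C [_ [/is_cliqueP cC /edgeE[e em ->] /forall_inP blk]].
(* Padding slots also need a witness, and any vertex [c0] of the clique serves. An empty clique is
   first enlarged to a singleton. *)
have [c0 [C' cC' [C'sub c0C]]] : exists c0, exists2 C' : {set V}, {in C' &, forall x y, codual E x y} &
    {subset C <= C'} /\ c0 \in C'.
  case: (set_0Vmem C) => [C0|[c cinC]]; last by exists c, C => //; split.
  have [v _] : exists v : V, v \in predT by apply/card_gt0P.
  exists v, [set v]; first by move=> x y /set1P -> /set1P ->.
  split; last exact: set11.
  by move=> x; rewrite C0 in_set0.
have wit j : j < 3 -> exists2 c, c \in C' & ~~ codualn (t e j) (label c).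
  move=> j3; case: (slotE em j3) => [->|[v tv]].
    by exists c0 => //; apply/negP => /codual_index_lt; rewrite ltnn.
  have /exists_inP[c cinC nc] := blk v (slot_in em j3 tv).
  by exists c; rewrite ?C'sub // tv codual_indexE.
have [x xC nx] := wit 0 isT; have [y yC ny] := wit 1 isT; have [z zC nz] := wit 2 isT.
apply/some_belowP; exists e => //; apply/some_belowP; exists (label x); rewrite ?label_lt //.
apply/some_belowP; exists (label y); rewrite ?label_lt //.
apply/some_belowP; exists (label z); rewrite ?label_lt //.
by rewrite /misses nx ny nz !codual_indexE !cC'.
Qed.

Lemma clauses_sym v : symmetric (clauses n m t v).
Proof.
move=> l l'; rewrite /clauses; congr (_ || _).
  rewrite codual_index_sym [(n < l) && _]andbC [(l == v) && _]andbC [(l == n) && _]andbC.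
  by congr orb; exact: orbC.
apply: eq_some_below => e _; rewrite /links /link_index.
by congr [|| _, _ | _]; congr andb; rewrite orbC ![(l' == _) && _]andbC.
Qed.

(** Models are characteristic functions of cliques [C]: two non-adjacent vertices give a clause of
    negations, v \/ false puts [v] in [C], and each hyperedge through [v] gives the clause on its
    two other slots. *)
Lemma clausesP v : (forall u, codual E u u) ->
  reflect (exists sigma, satisfied n (clauses n m t (label v)) 0 sigma)
    [exists C, is_clique E C && redundant_in E C v].
Proof.
move=> loops; have nL : n < n.*2.+2 by lia.
have lab_le u : label u <= n by rewrite ltnW ?label_lt.
have val_lab sigma u : value n sigma (label u) = sigma (label u).
  by rewrite /value lab_le /atom_value label_lt.
have neg_lab sigma u : value n sigma (label u + n + 1) = ~~ sigma (label u).
  by rewrite value_neg // val_lab.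
apply: (iffP existsP) => [[C /andP[/is_cliqueP cC /andP[vC /forall_inP red]]]|[sigma sat]].
  pose sigma x := [exists u in C, label u == x :> nat].
  have sigE u : sigma (label u) = (u \in C).
    apply/exists_inP/idP => [[w wC]|uC]; last by exists u.
    by rewrite label_eq => /eqP <-.
  have vT : value n sigma (label v) by rewrite val_lab sigE.
  exists sigma => l l' lL l'L _ _ /orP[/or3P[/andP[/andP[nl nl']]|/andP[/eqP ->]|/andP[_ /eqP ->]]|].
  - rewrite /value ![_ <= n]leqNgt nl nl' /= -negb_and /atom_value.
    rewrite -!subnDA addn1; apply: contra => /andP[/andP[a sa] /andP[b sb]].
    case: (label_onto a) sa => u eu; case: (label_onto b) sb => w ew.
    rewrite eu ew !sigE codual_indexE => wC uC; exact: cC.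
  - by rewrite vT.
  - by rewrite vT orbT.
  case/some_belowP => e em lk.
  (* The vertex of [C] in [e] other than [v], given by redundancy, sits in one of the two remaining
     slots. *)
  have hit j k : j < 3 -> k < 3 -> v \in edge e ->
      (forall x, x \in edge e -> x != v -> t e j = label x \/ t e k = label x) ->
      value n sigma (t e j) || value n sigma (t e k).
    move=> j3 k3 ve cov; move/implyP/(_ ve)/exists_inP: (red _ (edgeI em)) => [x xC].
    case/andP => xe /(cov x xe)[] ->; by rewrite val_lab sigE xC ?orbT.
  have step i j k : i < 3 -> j < 3 -> k < 3 ->
      (forall x, [|| x == t e i, x == t e j | x == t e k] = slot_mem t x e) ->
      link_index t (label v) l l' e (i, j, k) -> value n sigma l || value n sigma l'.
    move=> i3 j3 k3 slots /andP[/= /eqP ti lk'].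
    have ve := slot_in em i3 ti.
    have : value n sigma (t e j) || value n sigma (t e k).
      apply: hit => // x; rewrite -slot_memE // -slots ti label_eq => /or3P[/eqP-> | /eqP -> | /eqP ->] //.
      + by rewrite eqxx.
      + by left.
      + by right.
    by case/orP: lk' => /andP[/eqP -> /eqP ->] //; rewrite orbC.
  case/or3P: lk; apply: step => // x; rewrite /slot_mem //.
  - by rewrite orbCA.
  - by rewrite orbC -orbA.
exists [set u | sigma (label u)].
have vC : sigma (label v).
  rewrite -val_lab; have := sat (label v) n _ nL isT isT.
  rewrite value_false orbF; apply; first by rewrite ltnS (leq_trans (lab_le v)) //; lia.
  by rewrite /clauses !eqxx orbT.
apply/andP; split.
  apply/is_cliqueP => x y; rewrite !inE => sx sy; apply: contraLR sy => nxy.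
  have := sat _ _ (neg_lt (lab_le x)) (neg_lt (lab_le y)) isT isT.
  rewrite !neg_lab sx /=; apply; rewrite /clauses !unnegK codual_indexE nxy andbT.
  by apply/orP; left; apply/orP; left; rewrite -!addnA ![label _ + _]addnC addn1 !addSn !ltnS !leq_addr.
rewrite /redundant_in inE vC /=; apply/forall_inP => _ /edgeE[e em ->]; apply/implyP => ve.
have lit i : i < 3 -> t e i != label v -> value n sigma (t e i) ->
    exists2 x, x \in edge e & (sigma (label x)) && (x != v).
  move=> i3 tv; case: (slotE em i3) => [->|[x tx]]; first by rewrite value_false.
  rewrite tx val_lab => sx; exists x; first exact: slot_in tx.
  by rewrite sx -label_eq -tx.
suff [x xe /andP[sx xv]] : exists2 x, x \in edge e & (sigma (label x)) && (x != v).
  by apply/exists_inP; exists x; rewrite ?inE // xe.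
have step i j k : i < 3 -> j < 3 -> k < 3 -> i != j -> i != k ->
    link_index t (label v) (t e j) (t e k) e (i, j, k) ->
    links t (label v) (t e j) (t e k) e ->
    exists2 x, x \in edge e & (sigma (label x)) && (x != v).
  move=> i3 j3 k3 ij ik /andP[/eqP /= ti _] lk.
  have slotL j' : j' < 3 -> t e j' < n.*2.+2.
    by move=> j'3; have := slot_le em j'3; lia.
  (* Only padding may repeat within a row, so a true literal in another slot is a vertex different
     from [v]. *)
  have other j' : j' < 3 -> i != j' -> t e j' != label v.
    move=> j'3 ij'; apply/eqP => tj'; have := slot_inj em i3 j'3 ij'.
    by rewrite ti tj' => /(_ erefl) lv; have := label_lt v; rewrite lv ltnn.
  have /orP[] : value n sigma (t e j) || value n sigma (t e k).
    apply: sat; rewrite ?slotL // /clauses; apply/orP; right.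
    by apply/some_belowP; exists e.
  - by apply: lit; rewrite ?other.
  - by apply: lit; rewrite ?other.
have [i i3 ti] := slot_exists em ve.
have link a b : link_index t (label v) (t e a) (t e b) e (i, a, b).
  by rewrite /link_index /= ti !eqxx.
case: i i3 ti link => [|[|[|i]]] // i3 ti link.
- by apply: (step 0 1 2) => //; rewrite /links link.
- by apply: (step 1 0 2) => //; rewrite /links link orbT.
- by apply: (step 2 0 1) => //; rewrite /links link !orbT.
Qed.

(** If some vertex is not adjacent to itself, both sides are false. Otherwise the two tests match
    the last two conditions of [conformal_dualP]. *)
Lemma conformal_indexE :
  conformal (dual E) = ~~ (missed_index n m t || redundant_index n m t).
Proof.
case: (boolP [forall v, codual E v v]) => [/forallP loops|].
  rewrite negb_or; apply/conformal_dualP/andP => [[_ cover irr]|[nmiss nred]].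
    split; first by apply/(missed_indexP loops) => -[C [e [cC eE]]]; apply/negP/cover.
    apply/some_belowP => -[_ /label_onto[v ->]]; rewrite codual_indexE loops orbF.
    move/eliminationP => /(_ (@clauses_sym _)) /(clausesP _ loops)/existsP[C /andP[cC]].
    by apply/negP/irr.
  split=> // [C e cC eE|C v cC].
    by apply: contra nmiss => blk; apply/(missed_indexP loops); exists C, e.
  apply: contra nred => red; apply/some_belowP; exists (label v); first exact: label_lt.
  apply/orP; left; apply/eliminationP; first exact: clauses_sym.
  by apply/(clausesP _ loops)/existsP; exists C; rewrite cC.
rewrite negb_forall => /existsP[v nv].
have -> : redundant_index n m t.
  by apply/some_belowP; exists (label v); rewrite ?label_lt // codual_indexE nv orbT.
rewrite orbT; apply/negP => /conformal_dualP[loops _ _].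
by rewrite loops in nv.
Qed.

End Correctness.

(** * Semantics of the program *)

Lemma all_in_catl (s1 s2 : seq nat) : all [in s1 ++ s2] s1.
Proof. by apply/allP => x xs /=; rewrite mem_cat xs. Qed.

Lemma all_in_catr (s1 s2 : seq nat) : all [in s1 ++ s2] s2.
Proof. by apply/allP => x xs /=; rewrite mem_cat xs orbT. Qed.

Lemma all_in_cons x (s : seq nat) : all [in x :: s] s.
Proof. exact: (all_in_catr [:: x]). Qed.

Lemma all_in_refl (s : seq nat) : all [in s] s.
Proof. exact/allP. Qed.

Section Semantics.

Variables n m : nat.

Local Notation L := n.*2.+2.
Local Notation B := (4 * m + 3).

(** With hyperedges of at most three vertices the input takes at most [4 * m + 2] words, so the
    tables start beyond it. *)
Definition addr (q x y : nat) : nat := B + ((x * L + y) * 4 + q).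

Definition cell (s : state) (q x y : nat) : nat := mem s (addr q x y).

Definition good (s : state) : Prop :=
  [/\ regs s 1 = n, regs s 2 = m, regs s 3 = L, regs s 4 = B & regs s 5 = 3].

Lemma eval_cell s q x y : good s ->
  eval s (cell_expr q x y) = addr q (eval s x) (eval s y).
Proof. by case=> _ _ /= -> -> _. Qed.

Lemma eval_Get s q x y : good s ->
  eval s (Get q x y) = cell s q (eval s x) (eval s y).
Proof. by move=> gs; rewrite /cell -eval_cell. Qed.

Lemma denot_PSto s q x y e : good s ->
  denot (PSto q x y e) s = set_mem s (addr q (eval s x) (eval s y)) (eval s e).
Proof. by move=> gs; rewrite -eval_cell. Qed.

Lemma addr_region q q' x x' y y' : q < 4 -> q' < 4 ->
  addr q x y = addr q' x' y' -> q = q'.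
Proof. by rewrite /addr => h h'; lia. Qed.

Lemma addr_inj q x x' y y' : y < L -> y' < L ->
  addr q x y = addr q x' y' -> x = x' /\ y = y'.
Proof.
move=> yL y'L eqa; have eqs : x * L + y = x' * L + y' by move: eqa; rewrite /addr; lia.
have eqx : x = x'.
  by have := congr1 (divn^~ L) eqs; rewrite !divnMDl // !divn_small // !addn0.
by split=> //; move: eqs; rewrite eqx => /addnI.
Qed.

Lemma cell_set_mem s x y c x' y' q : y < L -> y' < L ->
  cell (set_mem s (addr q x y) c) q x' y' =
  if (x' == x) && (y' == y) then c else cell s q x' y'.
Proof.
move=> yL y'L; rewrite /cell /=; case: eqP => [/(addr_inj y'L yL)[-> ->]|ne].
  by rewrite !eqxx.
by case: ifP => // /andP[/eqP ex /eqP ey]; case: ne; rewrite ex ey.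
Qed.

(** What a program leaves untouched, as read off its syntax: registers and tables it does not write,
    and the whole area below the tables, which holds the input. *)
Record frame (p : prog) (s s' : state) : Prop := Frame {
  frame_good : good s';
  frame_regs : forall r, r \notin writes p -> regs s' r = regs s r;
  frame_cell : forall q x y, q < 4 -> q \notin regions p ->
    cell s' q x y = cell s q x y;
  frame_low : forall a, a < B -> mem s' a = mem s a }.

Lemma frame_refl p s : good s -> frame p s s.
Proof. by split. Qed.

Lemma frame_trans p p' s s' s'' :
  all [in writes p] (writes p') -> all [in regions p] (regions p') ->
  frame p s s' -> frame p' s' s'' -> frame p s s''.
Proof.
move=> /allP sw /allP sr [g1 r1 c1 l1] [g2 r2 c2 l2]; split=> // [r nr|q x y q4 nq|a aB].
- by rewrite r2 ?r1 //; apply: contra nr => /sw.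
- by rewrite c2 ?c1 //; apply: contra nq => /sr.
- by rewrite l2 ?l1.
Qed.

Lemma frame_set_reg p s s' r c : r \in writes p -> ~~ constant_reg r ->
  frame p s s' -> frame p s (set_reg s' r c).
Proof.
move=> rp ncr [[g1 g2 g3 g4 g5] fr fc fl].
have ne r' : constant_reg r' -> (r' == r) = false.
  by move=> cr'; apply: contraNF ncr => /eqP <-.
split=> //; first by split; rewrite /= ne.
by move=> r' nr' /=; case: eqP => [er|_]; [rewrite er rp in nr'|rewrite fr].
Qed.

Lemma denot_frame p s : wf p -> good s -> frame p s (denot p s).
Proof.
elim: p s => [|r e|r e c|q x y e|p1 IH1 p2 IH2|e p1 IH1 p2 IH2|r b p1 IH1] s.
- by move=> _; apply: frame_refl.
- by case/andP=> cr _ gs; apply: frame_set_reg; rewrite ?inE //; apply: frame_refl.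
- case/and3P=> cr _ _ gs; rewrite [denot _ _]/=; case: ifP => _; last exact: frame_refl.
  by apply: frame_set_reg; rewrite ?inE //; apply: frame_refl.
- case/and3P=> q4 _ _ gs; rewrite denot_PSto //; split=> //= [q' x' y' q'4|a aB].
    rewrite inE /cell /= => /eqP nq; case: eqP => // /addr_region eq.
    by case: nq; apply: eq.
  by rewrite /addr; case: eqP => // ea; lia.
- move=> /= /andP[w1 w2] gs; have f1 := IH1 s w1 gs.
  have f2 := IH2 _ w2 (frame_good f1).
  have fs : frame (PSeq p1 p2) s s by apply: frame_refl.
  apply: frame_trans f2; rewrite ?all_in_catr //.
  by apply: frame_trans fs f1; rewrite ?all_in_catl.
- move=> /= /and3P[_ w1 w2] gs; have fs : frame (PIf e p1 p2) s s by apply: frame_refl.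
  case: ifP => _; [have f := IH1 s w1 gs|have f := IH2 s w2 gs];
    by apply: (frame_trans _ _ fs f); rewrite ?all_in_catl ?all_in_catr.
- move=> /= /and4P[cr _ _ w1] gs.
  have rw : r \in writes (PFor r b p1) by rewrite inE eqxx.
  elim: (regs s b) => [|k IH] /=; apply: (frame_set_reg _ rw cr); first exact: frame_refl.
  apply: frame_trans IH (IH1 _ w1 (frame_good IH)); first exact: all_in_cons.
  exact: all_in_refl.
Qed.

Lemma denot_for (P : nat -> state -> Prop) r b p s : wf (PFor r b p) -> good s ->
  P 0 (set_reg s r 0) ->
  (forall k s', k < regs s b -> frame (PFor r b p) s s' -> regs s' r = k ->
     P k s' -> P k.+1 (set_reg (denot p s') r k.+1)) ->
  P (regs s b) (denot (PFor r b p) s).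
Proof.
move=> wfp gs P0 PS; have /and4P[cr cb nw wp] := wfp.
pose st k := iteri k (fun i s' => set_reg (denot p s') r i.+1) (set_reg s r 0).
have rw : r \in writes (PFor r b p) by rewrite inE eqxx.
have fr k : frame (PFor r b p) s (st k).
  elim: k => [|k IH]; apply: (frame_set_reg _ rw cr); first exact: frame_refl.
  apply: frame_trans IH (denot_frame wp (frame_good IH)); first exact: all_in_cons.
  exact: all_in_refl.
suff : forall k, k <= regs s b -> P k (st k) by apply.
elim=> // k IH kb; apply: PS => //; last by apply: IH; apply: ltnW.
by case: k {IH kb} => [|k] /=; rewrite eqxx.
Qed.

(** The common form of all searches: each round can only raise the flag [o], a register or a table
    entry, so the loop adds a disjunction over its counter. Nested loops are handled by repeated
    use. *)
Lemma denot_for_some (o : state -> bool) (Q : nat -> bool) r b p s k :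
  wf (PFor r b p) -> good s -> regs s b = k ->
  (forall s' c, o (set_reg s' r c) = o s') ->
  (forall s', frame (PFor r b p) s s' -> regs s' r < k ->
     o (denot p s') = o s' || Q (regs s' r)) ->
  o (denot (PFor r b p) s) = o s || some_below k Q.
Proof.
move=> wfp gs <- oset step.
apply: (@denot_for (fun k' s' => o s' = o s || some_below k' Q)) => //.
  by rewrite oset orbF.
move=> i s' ib fr ri os'.
rewrite oset step ?ri // os' -orbA; congr orb.
by rewrite /some_below -[i.+1]addn1 iotaD has_cat /= orbF.
Qed.

(** The value of [e] is required in every state that agrees with [s] outside table [q] and the two
    counters, which suits expressions that do not read table [q]. *)
Lemma denot_fill q e F s : wf (fill q e) -> good s ->
  (forall s', frame (fill q e) s s' -> regs s' 8 < L -> regs s' 9 < L ->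
     eval s' e = F (regs s' 8) (regs s' 9)) ->
  forall l l', l < L -> l' < L -> cell (denot (fill q e) s) q l l' = F l l'.
Proof.
move=> wfp gs evF; have wf9 : wf (PFor 9 3 (PSto q (Reg 8) (Reg 9) e)).
  by case/and4P: wfp.
have s3 s' : good s' -> regs s' 3 = L by case.
pose P k s' := forall l l', l < k -> l' < L -> cell s' q l l' = F l l'.
suff : P (regs s 3) (denot (fill q e) s) by rewrite s3.
apply: (denot_for (P := P)) => // k s' kL fr r8 IH.
have rs'3 := s3 _ (frame_good fr); rewrite s3 // in kL.
(* The entries before position [(k, k')] in lexicographic order are filled. *)
pose P' k' s'' := forall l l', l < k \/ l = k /\ l' < k' -> l' < L ->
  cell s'' q l l' = F l l'.
suff inner : P' (regs s' 3) (denot (PFor 9 3 (PSto q (Reg 8) (Reg 9) e)) s').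
  move=> l l' lk l'L; apply: inner => //; rewrite rs'3.
  by move: lk; rewrite ltnS leq_eqVlt => /orP[/eqP ->|lk]; [right|left].
apply: (denot_for (P := P')) => //; first exact: frame_good fr.
  by move=> l l' [lk|[]//] l'L; apply: IH.
move=> k' s'' k'L fr' r9 IH' l l' lk l'L; rewrite rs'3 in k'L.
have fr2 : frame (fill q e) s s''.
  by apply: frame_trans fr fr'; [apply: all_in_cons|apply: all_in_refl].
have r8' : regs s'' 8 = k by rewrite (frame_regs fr') // r8.
have gs'' := frame_good fr'.
have -> : denot (PSto q (Reg 8) (Reg 9) e) s'' = set_mem s'' (addr q k k') (F k k').
  by rewrite denot_PSto //= evF ?r8' ?r9.
have -> a b : cell (set_reg (set_mem s'' a b) 9 k'.+1) q l l' = cell (set_mem s'' a b) q l l'.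
  by [].
rewrite cell_set_mem //; case: ifP => [/andP[/eqP -> /eqP ->] //|ne].
by apply: IH' => //; lia.
Qed.

End Semantics.

Definition truth (s : state) (e : expr) : bool := eval s e != 0.

Lemma truth_and s a b : truth s (EAnd a b) = truth s a && truth s b.
Proof. by rewrite /truth /= muln_eq0 negb_or. Qed.

Lemma truth_not s a : truth s (ENot a) = ~~ truth s a.
Proof. by rewrite /truth /= eqb0. Qed.

Lemma truth_or s a b : truth s (EOr a b) = truth s a || truth s b.
Proof. by rewrite truth_not truth_and !truth_not negb_and !negbK. Qed.

Lemma truth_eq s a b : truth s (EEq a b) = (eval s a == eval s b).
Proof. by rewrite /truth /= eqb0 negbK. Qed.

Lemma truth_lt s a b : truth s (ELt a b) = (eval s a < eval s b).
Proof. by rewrite /truth /= eqb0 negbK. Qed.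

Definition truthE := (truth_and, truth_or, truth_not, truth_eq, truth_lt).

Arguments cell : simpl never.

Lemma lt_side n k : k <= n -> k < n.*2.+2.
Proof. lia. Qed.

(** * The stages of the program compute the tests on labels *)

Section Specifications.

Variables (n m : nat) (t : nat -> nat -> nat).
Hypothesis t_le : forall e j, e < m -> j < 3 -> t e j <= n.

Local Notation L := n.*2.+2.
Local Notation good := (good n m).
Local Notation cell := (cell n m).
Local Notation codualn := (codual_index n m t).

Definition slots_ok (s : state) : Prop :=
  forall e j, e < m -> j < 3 -> cell s 0 e j = t e j.

Definition codual_ok (s : state) : Prop :=
  forall x y, x <= n -> y <= n -> (cell s 1 x y != 0) = codualn x y.

Lemma frame_slots p s s' : frame n m p s s' -> 0 \notin regions p ->
  slots_ok s -> slots_ok s'.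
Proof. by move=> fr r0 ok e j em j3; rewrite (frame_cell fr) // ok. Qed.

Lemma frame_codual p s s' : frame n m p s s' -> 1 \notin regions p ->
  codual_ok s -> codual_ok s'.
Proof. by move=> fr r0 ok x y xn yn; rewrite (frame_cell fr) // ok. Qed.

Lemma eval_slot s e j : good s -> slots_ok s -> eval s e < m -> j < 3 ->
  eval s (Get 0 e (Num j)) = t (eval s e) j.
Proof. by move=> gs ok em j3; rewrite (eval_Get _ _ _ gs) ok. Qed.

Lemma truth_mem s x e : good s -> slots_ok s -> eval s e < m ->
  truth s (EMem x e) = slot_mem t (eval s x) (eval s e).
Proof. by move=> gs ok em; rewrite !truthE !eval_slot. Qed.

Lemma truth_covered s x : good s -> slots_ok s -> regs s 7 < m -> regs s 8 < m ->
  truth s (covered_expr x) = covered n t (regs s 7) (regs s 8) (eval s x).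
Proof.
by move=> gs ok em fm; rewrite truth_or truth_or truth_eq !truth_mem //=; case: gs => ->.
Qed.

Lemma truth_block s : good s -> slots_ok s ->
  regs s 7 < m -> regs s 8 < m -> regs s 11 < m ->
  truth s block_expr =
  blocking n t (regs s 7) (regs s 8) (regs s 12) (regs s 13) (regs s 11).
Proof.
by move=> gs ok em fm gm; rewrite !truth_and !truth_covered // truth_not truth_or !truth_mem ?eval_slot.
Qed.

Lemma truth_private s : good s -> slots_ok s -> regs s 7 < m -> regs s 8 < m ->
  truth s private_expr = private n t (regs s 7) (regs s 8) (regs s 12) (regs s 13).
Proof.
move=> gs ok em fm; rewrite truth_and [truth s (EOr _ _)]truth_or truth_not truth_or !truth_mem //.
by rewrite !truthE /=; case: gs => ->.
Qed.

Lemma denot_PIf s e p1 p2 : 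
  denot (PIf e p1 p2) s = if truth s e then denot p1 s else denot p2 s.
Proof. by []. Qed.

Lemma denot_adj_body s x y : good s -> slots_ok s -> x <= n -> y <= n ->
  regs s 7 < m -> regs s 8 < m -> regs s 9 < 3 -> regs s 10 < 3 ->
  (cell (denot adj_body s) 1 x y != 0) =
  (cell s 1 x y != 0) ||
  codual_slot n m t x y (regs s 7) (regs s 8) (regs s 9) (regs s 10).
Proof.
move=> gs ok xn yn em fm i3 j3; rewrite /codual_slot.
set e := regs s 7; set f := regs s 8; set i := regs s 9; set j := regs s 10.
pose pre := PSeq (PAsg 12 (Get 0 (Reg 7) (Reg 9)))
  (PSeq (PAsg 13 (Get 0 (Reg 8) (Reg 10))) (PAsg 14 (ENot private_expr))).
pose s1 := denot pre s.
have fr1 : frame n m pre s s1 by apply: denot_frame.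
have gs1 := frame_good fr1.
have ok1 : slots_ok s1 by apply: frame_slots fr1 _ ok.
have eu : eval s (Get 0 (Reg 7) (Reg 9)) = t e i by rewrite (eval_Get _ _ _ gs) ok.
have ew s' : good s' -> slots_ok s' -> regs s' 8 = f -> regs s' 10 = j ->
    eval s' (Get 0 (Reg 8) (Reg 10)) = t f j.
  by move=> gs' ok' e8 e10; rewrite (eval_Get _ _ _ gs') /= e8 e10 ok'.
have r12 : regs s1 12 = t e i by rewrite /s1 /pre -eu.
have r13 : regs s1 13 = t f j.
  pose sa := denot (PAsg 12 (Get 0 (Reg 7) (Reg 9))) s.
  have fra : frame n m (PAsg 12 (Get 0 (Reg 7) (Reg 9))) s sa by apply: denot_frame.
  by rewrite -(ew sa).
have r1 r : r \notin [:: 12; 13; 14] -> regs s1 r = regs s r by apply: (frame_regs fr1).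
have r14 : (regs s1 14 != 0) = ~~ private n t e f (t e i) (t f j).
  pose sb := denot (PSeq (PAsg 12 (Get 0 (Reg 7) (Reg 9))) (PAsg 13 (Get 0 (Reg 8) (Reg 10)))) s.
  have frb : frame n m (PSeq (PAsg 12 (Get 0 (Reg 7) (Reg 9))) (PAsg 13 (Get 0 (Reg 8) (Reg 10)))) s sb.
    exact: denot_frame.
  have -> : (regs s1 14 != 0) = truth sb (ENot private_expr) by [].
  have okb := frame_slots frb isT ok; have gsb := frame_good frb.
  rewrite truth_not truth_private //; first by rewrite -r12 -r13.
pose s2 := denot (PFor 11 2 adj_block) s1.
have fr2 : frame n m (PFor 11 2 adj_block) s1 s2 by apply: denot_frame.
have rm : regs s1 2 = m by case: gs1.
have r14' : (regs s2 14 != 0) = ~~ private n t e f (t e i) (t f j) ||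
    some_below m (blocking n t e f (t e i) (t f j)).
  rewrite -r14.
  apply: (@denot_for_some n m (fun s' => regs s' 14 != 0)) => // s' fr' gm.
  have rs' r : r \notin [:: 11; 14] -> regs s' r = regs s1 r by apply: (frame_regs fr').
  have [e7 e8] : regs s' 7 = e /\ regs s' 8 = f by rewrite !rs' // !r1.
  have [e12 e13] : regs s' 12 = t e i /\ regs s' 13 = t f j by rewrite !rs' // r12 r13.
  rewrite /adj_block denot_PIf truth_block ?e7 ?e8 ?e12 ?e13 //.
  - by case: ifP => //=; rewrite ?orbT ?orbF.
  - exact: frame_good fr'.
  - exact: frame_slots fr' _ ok1.
have -> : denot adj_body s = denot (PIf (Reg 14) PSkip (PSto 1 (Reg 12) (Reg 13) (Num 1))) s2.
  by [].
have c2 : cell s2 1 x y = cell s 1 x y.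
  by rewrite (frame_cell fr2) // (frame_cell fr1).
have [e12 e13] : regs s2 12 = t e i /\ regs s2 13 = t f j.
  by rewrite !(frame_regs fr2) // r12 r13.
have dS : denot (PSto 1 (Reg 12) (Reg 13) (Num 1)) s2 = set_mem s2 (addr n m 1 (t e i) (t f j)) 1.
  by rewrite (denot_PSto _ _ _ _ (frame_good fr2)) /= e12 e13.
rewrite denot_PIf dS -[truth s2 (Reg 14)]/(regs s2 14 != 0) r14' -c2.
case: (private _ _ _ _ _ _) => /=; last by rewrite orbF.
case: (some_below _ _) => /=; first by rewrite orbF.
rewrite cell_set_mem ?lt_side // ?t_le //.
by case: ifP; rewrite ?orbT ?orbF.
Qed.

Lemma denot_adjacency s : good s -> slots_ok s ->
  (forall x y, x <= n -> y <= n -> cell s 1 x y = 0) -> codual_ok (denot adjacency s).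
Proof.
move=> gs ok z x y xn yn.
(* The zero entry supplies the initial flag expected by [denot_for_some]. *)
rewrite -[RHS]orFb; have {1}-> : false = (cell s 1 x y != 0) by rewrite z.
have r2 s' : good s' -> regs s' 2 = m by case.
have r5 s' : good s' -> regs s' 5 = 3 by case.
apply: (@denot_for_some n m (fun s' => cell s' 1 x y != 0)); rewrite ?r2 // => s1 fr1 em.
have gs1 := frame_good fr1; have ok1 := frame_slots fr1 isT ok.
apply: (@denot_for_some n m (fun s' => cell s' 1 x y != 0)); rewrite ?r2 // => s2 fr2 fm.
have gs2 := frame_good fr2; have ok2 := frame_slots fr2 isT ok1.
apply: (@denot_for_some n m (fun s' => cell s' 1 x y != 0)); rewrite ?r5 // => s3 fr3 i3.
have gs3 := frame_good fr3; have ok3 := frame_slots fr3 isT ok2.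
apply: (@denot_for_some n m (fun s' => cell s' 1 x y != 0)); rewrite ?r5 // => s4 fr4 j3.
have gs4 := frame_good fr4; have ok4 := frame_slots fr4 isT ok3.
have e9 : regs s4 9 = regs s3 9 by rewrite (frame_regs fr4).
have e8 : regs s4 8 = regs s2 8 by rewrite (frame_regs fr4) ?(frame_regs fr3).
have e7 : regs s4 7 = regs s1 7.
  by rewrite (frame_regs fr4) ?(frame_regs fr3) ?(frame_regs fr2).
by rewrite denot_adj_body ?e7 ?e8 ?e9.
Qed.

Lemma denot_missed s : good s -> slots_ok s -> codual_ok s ->
  (regs (denot missed s) 0 != 0) = (regs s 0 != 0) || missed_index n m t.
Proof.
move=> gs ok cok.
have r2 s' : good s' -> regs s' 2 = m by case.
have r1 s' : good s' -> regs s' 1 = n by case.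
apply: (@denot_for_some n m (fun s' => regs s' 0 != 0)); rewrite ?r2 // => s1 fr1 em.
have gs1 := frame_good fr1; have ok1 := frame_slots fr1 isT ok.
have cok1 := frame_codual fr1 isT cok.
apply: (@denot_for_some n m (fun s' => regs s' 0 != 0)); rewrite ?r1 // => s2 fr2 xn.
have gs2 := frame_good fr2; have ok2 := frame_slots fr2 isT ok1.
have cok2 := frame_codual fr2 isT cok1.
apply: (@denot_for_some n m (fun s' => regs s' 0 != 0)); rewrite ?r1 // => s3 fr3 yn.
have gs3 := frame_good fr3; have ok3 := frame_slots fr3 isT ok2.
have cok3 := frame_codual fr3 isT cok2.
apply: (@denot_for_some n m (fun s' => regs s' 0 != 0)); rewrite ?r1 // => s4 fr4 zn.
have gs4 := frame_good fr4; have ok4 := frame_slots fr4 isT ok3.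
have cok4 := frame_codual fr4 isT cok3.
have e9 : regs s4 9 = regs s3 9 by rewrite (frame_regs fr4).
have e8 : regs s4 8 = regs s2 8 by rewrite (frame_regs fr4) ?(frame_regs fr3).
have e7 : regs s4 7 = regs s1 7.
  by rewrite (frame_regs fr4) ?(frame_regs fr3) ?(frame_regs fr2).
rewrite -e7 -e8 -e9 in em xn yn *.
have tG x y : eval s4 x <= n -> eval s4 y <= n ->
    truth s4 (Get 1 x y) = codualn (eval s4 x) (eval s4 y).
  by move=> xn' yn'; rewrite /truth (eval_Get _ _ _ gs4) cok4.
rewrite /missed_body denot_PIf.
have -> : truth s4 missed_expr = misses n m t (regs s4 7) (regs s4 8) (regs s4 9) (regs s4 10).
  rewrite !truth_and !truth_not !tG ?eval_slot //; try exact: t_le; try exact: ltnW.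
by case: ifP; rewrite /= ?orbT ?orbF.
Qed.

Lemma eval_EOr s a b : eval s (EOr a b) = truth s (EOr a b) :> nat.
Proof. by rewrite /truth /=; case: (_ == 0). Qed.

Lemma denot_clauses s : good s -> codual_ok s ->
  forall l l', l < L -> l' < L ->
  (cell (denot (fill 2 clause_expr) s) 2 l l' != 0) =
  [|| ((n < l) && (n < l')) && ~~ codualn (l - n - 1) (l' - n - 1),
    (l == regs s 7) && (l' == n) | (l == n) && (l' == regs s 7)].
Proof.
move=> gs cok l l' lL l'L.
pose F a b : nat := [|| ((n < a) && (n < b)) && ~~ codualn (a - n - 1) (b - n - 1),
    (a == regs s 7) && (b == n) | (a == n) && (b == regs s 7)].
rewrite (@denot_fill n m 2 clause_expr F) //; first by rewrite /F eqb0 negbK.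
move=> s' fr r8 r9; have gs' := frame_good fr; have cok' := frame_codual fr isT cok.
have r1 : regs s' 1 = n by case: gs'.
have r7 : regs s' 7 = regs s 7 by rewrite (frame_regs fr).
rewrite eval_EOr /F truth_or truth_and truth_not truth_and truth_or !truth_and.
rewrite !truth_lt !truth_eq {1}/truth (eval_Get _ _ _ gs') cok' /= r1 ?r7 //; lia.
Qed.

Lemma denot_link_clause s i j k l l' : good s -> slots_ok s -> regs s 11 < m ->
  i < 3 -> j < 3 -> k < 3 -> l < L -> l' < L ->
  (cell (denot (link_clause i j k) s) 2 l l' != 0) =
  (cell s 2 l l' != 0) || link_index t (regs s 7) l l' (regs s 11) (i, j, k).
Proof.
move=> gs ok em i3 j3 k3 lL l'L.
rewrite denot_PIf truth_eq eval_slot // /link_index.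
rewrite -[eval s (Reg 11)]/(regs s 11) -[eval s (Reg 7)]/(regs s 7).
case: ifP => _; last by rewrite orbF.
set e := regs s 11.
have tL j' : j' < 3 -> t e j' < L by move=> j'3; rewrite lt_side ?t_le.
pose s1 := denot (PSto 2 (Get 0 (Reg 11) (Num j)) (Get 0 (Reg 11) (Num k)) (Num 1)) s.
rewrite -[denot _ s]/(denot (PSto 2 (Get 0 (Reg 11) (Num k)) (Get 0 (Reg 11) (Num j)) (Num 1)) s1).
have s1E : s1 = set_mem s (addr n m 2 (t e j) (t e k)) 1.
  by rewrite /s1 (denot_PSto _ _ _ _ gs) !eval_slot.
(* A frame depends on a store only through its table, so a dummy store stands in. With symbolic
   slots [j] and [k], well-formedness of the actual one does not compute. *)
have fr1 : frame n m (PSto 2 (Num 0) (Num 0) (Num 0)) s s1.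
  rewrite s1E; split=> // [q x y q4|a aB].
    rewrite inE /@cell /= => /eqP nq; case: eqP => // /addr_region eq.
    by case: nq; apply: eq.
  by rewrite /= /addr; case: eqP => // ea; lia.
have gs1 := frame_good fr1; have ok1 := frame_slots fr1 isT ok.
have r11 : regs s1 11 = e by rewrite s1E.
rewrite (denot_PSto _ _ _ _ gs1) !eval_slot ?r11 // cell_set_mem ?tL // s1E cell_set_mem ?tL //.
rewrite /= -/e; case: ((l == t e k) && _); first by rewrite !orbT.
by case: (_ && _); rewrite ?orbT ?orbF.
Qed.

Lemma denot_link_body s l l' : good s -> slots_ok s -> regs s 11 < m ->
  l < L -> l' < L ->
  (cell (denot link_body s) 2 l l' != 0) =
  (cell s 2 l l' != 0) || links t (regs s 7) l l' (regs s 11).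
Proof.
move=> gs ok em lL l'L.
pose s1 := denot (link_clause 0 1 2) s; pose s2 := denot (link_clause 1 0 2) s1.
have fr1 : frame n m (link_clause 0 1 2) s s1 by apply: denot_frame.
have gs1 := frame_good fr1; have ok1 := frame_slots fr1 isT ok.
have fr2 : frame n m (link_clause 1 0 2) s1 s2 by apply: denot_frame.
have gs2 := frame_good fr2; have ok2 := frame_slots fr2 isT ok1.
have [r7 r11] : regs s1 7 = regs s 7 /\ regs s1 11 = regs s 11.
  by rewrite !(frame_regs fr1).
have [r7' r11'] : regs s2 7 = regs s 7 /\ regs s2 11 = regs s 11.
  by rewrite !(frame_regs fr2).
rewrite -[denot link_body s]/(denot (link_clause 2 0 1) s2).
rewrite denot_link_clause ?r11' // denot_link_clause ?r11 // denot_link_clause //.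
by rewrite r7 r7' /links !orbA.
Qed.

Definition matrix_is (s : state) (M : nat -> nat -> bool) : Prop :=
  forall l l', l < L -> l' < L -> (cell s 2 l l' != 0) = M l l'.

Lemma truth_half s M k l : good s -> matrix_is s M -> eval s k < L -> eval s l < L ->
  truth s (half_expr k l) = half_clause n M (eval s k) (eval s l).
Proof.
move=> gs ok kL lL; have r1 : regs s 1 = n by case: gs.
rewrite truth_or truth_and truth_eq ![truth _ (Get _ _ _)]/truth !(eval_Get _ _ _ gs).
by rewrite !ok //= r1.
Qed.

Lemma denot_resolve s M : good s -> matrix_is s M -> regs s 10 < n ->
  matrix_is (denot resolve s) (resolved n (regs s 10) M).
Proof.
move=> gs ok kn; set k := regs s 10.
pose s1 := denot (fill 3 resolve_expr) s.
have fr1 : frame n m (fill 3 resolve_expr) s s1 by apply: denot_frame.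
pose F a b : nat := resolved n k M a b.
have c1 l l' : l < L -> l' < L -> cell s1 3 l l' = F l l'.
  apply: denot_fill => // s' fr r8 r9; have gs' := frame_good fr.
  have ok' : matrix_is s' M by move=> a b aL bL; rewrite (frame_cell fr) // ok.
  have r1 : regs s' 1 = n by case: gs'.
  have r10 : regs s' 10 = k by rewrite (frame_regs fr).
  have kL : k < L by rewrite lt_side // ltnW.
  have nkL : k + n + 1 < L by apply: neg_lt; apply: ltnW.
  have ek : eval s' (Reg 10) = k by [].
  have enk : eval s' (neg_expr (Reg 10)) = k + n + 1 by rewrite /= r10 r1.
  rewrite eval_EOr truth_or truth_or !truth_and !(truth_half gs' ok') ?ek ?enk //.
  by rewrite /truth (eval_Get _ _ _ gs') ok'.
move=> l l' lL l'L.
rewrite -[denot resolve s]/(denot (fill 2 (Get 3 (Reg 8) (Reg 9))) s1).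
rewrite (@denot_fill n m 2 _ F) //; first by rewrite /F eqb0 negbK.
  exact: frame_good fr1.
move=> s' fr r8 r9; rewrite (eval_Get _ _ _ (frame_good fr)).
by rewrite (frame_cell fr) // c1.
Qed.

Lemma denot_redundant_body s : good s -> slots_ok s -> codual_ok s -> regs s 7 < n ->
  (regs (denot redundant_body s) 0 != 0) =
  (regs s 0 != 0) || (~~ iteri n (resolved n) (clauses n m t (regs s 7)) n n
    || ~~ codualn (regs s 7) (regs s 7)).
Proof.
move=> gs ok cok vn; set v := regs s 7.
pose s1 := denot (fill 2 clause_expr) s.
have fr1 : frame n m (fill 2 clause_expr) s s1 by apply: denot_frame.
have gs1 := frame_good fr1; have ok1 := frame_slots fr1 isT ok.
have cok1 := frame_codual fr1 isT cok.
have r7 : regs s1 7 = v by rewrite (frame_regs fr1).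
pose s2 := denot (PFor 11 2 link_body) s1.
have fr2 : frame n m (PFor 11 2 link_body) s1 s2 by apply: denot_frame.
have gs2 := frame_good fr2; have cok2 := frame_codual fr2 isT cok1.
have r7' : regs s2 7 = v by rewrite (frame_regs fr2).
have M2 : matrix_is s2 (clauses n m t v).
  move=> l l' lL l'L; rewrite /clauses -denot_clauses // -/s1.
  apply: (@denot_for_some n m (fun s' => cell s' 2 l l' != 0)) => //; first by case: gs1.
  move=> s' fr em; have e7 : regs s' 7 = v by rewrite (frame_regs fr).
  rewrite denot_link_body ?e7 //; first exact: frame_good fr.
  exact: frame_slots fr _ ok1.
pose s3 := denot (PFor 10 1 resolve) s2.
have fr3 : frame n m (PFor 10 1 resolve) s2 s3 by apply: denot_frame.
have gs3 := frame_good fr3; have cok3 := frame_codual fr3 isT cok2.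
have r7'' : regs s3 7 = v by rewrite (frame_regs fr3).
have r1 s' : good s' -> regs s' 1 = n by case.
have M3 : matrix_is s3 (iteri n (resolved n) (clauses n m t v)).
  pose P k s' := matrix_is s' (iteri k (resolved n) (clauses n m t v)).
  rewrite -[X in iteri X]/n; suff : P (regs s2 1) s3 by rewrite r1.
  apply: (denot_for (n := n) (m := m) (P := P)) => // k s' kn fr rk Mk.
  rewrite /P /= -rk; apply: denot_resolve; rewrite ?rk //; first exact: frame_good fr.
  by rewrite r1 in kn.
rewrite -[denot redundant_body s]/(denot (PIf verdict_expr (PAsg 0 (Num 1)) PSkip) s3).
have r0 : regs s3 0 = regs s 0 by rewrite (frame_regs fr3) ?(frame_regs fr2) ?(frame_regs fr1).
rewrite denot_PIf truth_or !truth_not /truth !(eval_Get _ _ _ gs3).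
rewrite M3 ?cok3 /= ?r7'' ?r1 ?lt_side //; try exact: ltnW.
by case: ifP; rewrite /= ?r0 ?orbT ?orbF.
Qed.

Lemma denot_redundant s : good s -> slots_ok s -> codual_ok s ->
  (regs (denot redundant s) 0 != 0) = (regs s 0 != 0) || redundant_index n m t.
Proof.
move=> gs ok cok.
apply: (@denot_for_some n m (fun s' => regs s' 0 != 0)) => //; first by case: gs.
move=> s1 fr1 vn; apply: denot_redundant_body => //; first exact: frame_good fr1.
  exact: frame_slots fr1 _ ok.
exact: frame_codual fr1 _ cok.
Qed.

End Specifications.

(** * Reading the hyperedges into table 0 *)

Section Parsing.

Variables (n : nat) (ls : seq (seq nat)).
Hypothesis n_gt0 : 0 < n.
Hypothesis ls_le3 : forall e, e \in ls -> size e <= 3.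

Local Notation m := (size ls).
Local Notation B := (4 * m + 3).
Local Notation good := (good n m).
Local Notation cell := (cell n m).

Definition blocks : seq (seq nat) := [seq size e :: e | e <- ls].

(** The default value [n] is the padding of short hyperedges. *)
Definition slot (e j : nat) : nat := nth n (nth [::] ls e) j.

Lemma size_blocks k : k <= m -> size (flatten (take k blocks)) <= 4 * k.
Proof.
elim: k => [|k IH] km; first by rewrite take0.
rewrite (take_nth [::]) ?size_map // -cats1 flatten_cat size_cat /= cats0.
rewrite (nth_map [::]) // mulnS addnC leq_add //; last exact: IH (ltnW km).
by rewrite /= ltnS ls_le3 ?mem_nth.
Qed.

Lemma nth_blocks k j : k < m -> j < size (nth [::] blocks k) ->
  nth 0 (flatten blocks) (size (flatten (take k blocks)) + j)
  = nth 0 (nth [::] blocks k) j.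
Proof.
move=> km jk; rewrite -{1}(cat_take_drop k blocks) flatten_cat nth_cat ltnNge leq_addr /=.
by rewrite addKn (drop_nth [::]) ?size_map //= nth_cat jk.
Qed.

Lemma denot_parse s : good s ->
  (forall a, a < B -> mem s a = nth 0 [:: n, m & flatten blocks] a) ->
  slots_ok n m slot (denot parse s).
Proof.
move=> gs inp.
(* The address of the size word of hyperedge [k], after the two leading words. *)
pose offset k := 2 + size (flatten (take k blocks)).
have read k j : k < m -> j <= size (nth [::] ls k) ->
    offset k + j < B /\
    nth 0 [:: n, m & flatten blocks] (offset k + j) = nth 0 (size (nth [::] ls k) :: nth [::] ls k) j.
  move=> km jk; split.
    have ok : offset k <= 2 + 4 * k by rewrite leq_add2l size_blocks // ltnW.
    have j3 : j <= 3 by rewrite (leq_trans jk) // ls_le3 ?mem_nth.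
    by clear -km ok j3; lia.
  rewrite /offset -addnA /= nth_blocks // (nth_map [::]) //=.
pose body := PSeq (PFor 8 5
        (PIf (ELt (Reg 8) (Fetch (Reg 6)))
          (PSto 0 (Reg 7) (Reg 8)
            (Fetch (Op OpAdd (Op OpAdd (Reg 6) (Num 1)) (Reg 8))))
          (PSto 0 (Reg 7) (Reg 8) (Reg 1))))
      (PAdv 6 (Op OpAdd (Num 1) (Fetch (Reg 6))) 4).
pose s0 := denot (PAsg 6 (Num 2)) s.
have fr0 : frame n m (PAsg 6 (Num 2)) s s0 by apply: denot_frame.
have gs0 := frame_good fr0.
have low0 a : a < B -> mem s0 a = nth 0 [:: n, m & flatten blocks] a.
  by move=> aB; rewrite (frame_low fr0) // inp.
pose P k s' := regs s' 6 = offset k /\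
  forall e j, e < k -> j < 3 -> cell s' 0 e j = slot e j.
suff : P (regs s0 2) (denot (PFor 7 2 body) s0).
  by case: (gs0) => _ -> _ _ _ [_].
apply: (denot_for (n := n) (m := m) (P := P)) => //; first by rewrite /P /offset take0.
move=> k s1 km fr1 r7 [r6 IH].
have {}km : k < m by case: (gs0) km => _ -> _ _ _.
have gs1 := frame_good fr1.
have low1 a : a < B -> mem s1 a = nth 0 [:: n, m & flatten blocks] a.
  by move=> aB; rewrite (frame_low fr1) // low0.
have [] := read k 0 km isT; rewrite addn0 => ok0 header.
pose copy := PFor 8 5
        (PIf (ELt (Reg 8) (Fetch (Reg 6)))
          (PSto 0 (Reg 7) (Reg 8)
            (Fetch (Op OpAdd (Op OpAdd (Reg 6) (Num 1)) (Reg 8))))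
          (PSto 0 (Reg 7) (Reg 8) (Reg 1))).
pose s2 := denot copy s1.
have fr2 : frame n m copy s1 s2 by apply: denot_frame.
have gs2 := frame_good fr2.
have cells2 e j : e < k.+1 -> j < 3 -> cell s2 0 e j = slot e j.
  pose P' k' s' := forall e j, e < k \/ e = k /\ j < k' -> j < 3 -> cell s' 0 e j = slot e j.
  suff inner : P' (regs s1 5) s2.
    move=> ek j3; apply: inner => //; have -> : regs s1 5 = 3 by case: gs1.
    by move: ek; rewrite ltnS leq_eqVlt => /orP[/eqP ->|ek]; [right|left].
  apply: (denot_for (n := n) (m := m) (P := P')) => //.
    by move=> e' j' [ek|[]//] j'3; apply: IH.
  move=> k' s3 + fr3 r8 IH'; have -> : regs s1 5 = 3 by case: gs1.
  move=> k'3 e' j' ek j'3; have gs3 := frame_good fr3.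
  have [e6 e7] : regs s3 6 = offset k /\ regs s3 7 = k by rewrite !(frame_regs fr3).
  have e1 : regs s3 1 = n by case: gs3.
  have low3 a : a < B -> mem s3 a = nth 0 [:: n, m & flatten blocks] a.
    by move=> aB; rewrite (frame_low fr3) // low1.
  have k'L : k' < n.*2.+2 by lia.
  have j'L : j' < n.*2.+2 by lia.
  have -> d : cell (set_reg d 8 k'.+1) 0 e' j' = cell d 0 e' j' by [].
  pose value := Fetch (Op OpAdd (Op OpAdd (Reg 6) (Num 1)) (Reg 8)).
  have ev : k' < size (nth [::] ls k) -> eval s3 value = slot k k'.
    move=> lt; have [ok rd] := read k k'.+1 km lt.
    rewrite -[eval s3 value]/(mem s3 (regs s3 6 + 1 + regs s3 8)) e6 r8 addn1 addSnnS.
    rewrite low3 // rd /slot -[LHS]/(nth 0 (nth [::] ls k) k').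
    exact: set_nth_default.
  have -> : denot (PIf (ELt (Reg 8) (Fetch (Reg 6))) (PSto 0 (Reg 7) (Reg 8) value)
      (PSto 0 (Reg 7) (Reg 8) (Reg 1))) s3 = set_mem s3 (addr n m 0 k k') (slot k k').
    rewrite denot_PIf truth_lt !(denot_PSto _ _ _ _ gs3) -[eval s3 (Reg 7)]/(regs s3 7).
    rewrite -[eval s3 (Reg 8)]/(regs s3 8) e7 r8 -[eval s3 (Reg 1)]/(regs s3 1) e1.
    have -> : eval s3 (Fetch (Reg 6)) = size (nth [::] ls k) by rewrite /= e6 low3 // header.
    case: ltnP => [/ev -> //|le]; by rewrite /slot nth_default.
  rewrite cell_set_mem //; case: ifP => [/andP[/eqP -> /eqP ->] //|ne].
  apply: IH' => //; case: ek => [ek|[ek j'k]]; [by left|right].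
  by split=> //; move: j'k ne; rewrite ltnS leq_eqVlt ek eqxx /= => /orP[->|].
have -> : denot body s1 = denot (PAdv 6 (Op OpAdd (Num 1) (Fetch (Reg 6))) 4) s2 by [].
have e6 : regs s2 6 = offset k by rewrite (frame_regs fr2).
have e4 : regs s2 4 = B by case: gs2.
have -> : denot (PAdv 6 (Op OpAdd (Num 1) (Fetch (Reg 6))) 4) s2 = set_reg s2 6 (offset k.+1).
  have hd : eval s2 (Fetch (Reg 6)) = size (nth [::] ls k).
    by rewrite /= e6 (frame_low fr2) // low1 // header.
  have eo : regs s2 6 + eval s2 (Op OpAdd (Num 1) (Fetch (Reg 6))) = offset k.+1.
    rewrite e6 /= in hd *; rewrite hd /offset (take_nth [::]) ?size_map // -cats1.
    by rewrite flatten_cat size_cat /= cats0 (nth_map [::]) //= add1n addnA.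
  (* The guard of [PAdv] passes: each hyperedge takes at most four words. *)
  have lt : offset k.+1 < B.
    have ok : offset k.+1 <= 2 + 4 * k.+1 by rewrite leq_add2l size_blocks.
    by clear -km ok; lia.
  rewrite [LHS]/= -[regs s2 6 + _]/(regs s2 6 + eval s2 (Op OpAdd (Num 1) (Fetch (Reg 6)))).
  by rewrite eo e4 lt.
by split=> // e j ek j3; exact: cells2.
Qed.

End Parsing.

(** * Running time *)

Lemma denot_main n ls s : 0 < n -> (forall e, e \in ls -> size e <= 3) ->
  (forall e j, e < size ls -> j < 3 -> slot n ls e j <= n) ->
  good n (size ls) s -> regs s 0 = 0 ->
  (forall a, mem s a = nth 0 [:: n, size ls & flatten (blocks ls)] a) ->
  regs (denot main s) 0
  = ~~ (missed_index n (size ls) (slot n ls) || redundant_index n (size ls) (slot n ls)).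
Proof.
move=> n0 ls3 slot_le gs r0 inp; set m := size ls; set t := slot n ls.
pose s1 := denot parse s; pose s2 := denot adjacency s1.
pose s3 := denot missed s2; pose s4 := denot redundant s3.
have fr1 : frame n m parse s s1 by apply: denot_frame.
have gs1 := frame_good fr1.
have ok1 : slots_ok n m t s1 by apply: denot_parse.
have fr2 : frame n m adjacency s1 s2 by apply: denot_frame.
have gs2 := frame_good fr2; have ok2 := frame_slots fr2 isT ok1.
have cok2 : codual_ok n m t s2.
  apply: denot_adjacency => // x y xn yn; rewrite (frame_cell fr1) // /cell inp nth_default //=.
  have := size_blocks ls3 (leqnn _); rewrite take_oversize ?size_map // => sz.
  by rewrite /addr (leq_trans _ (leq_addr _ _)) // addn3 !ltnS leqW.
have fr3 : frame n m missed s2 s3 by apply: denot_frame.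
have gs3 := frame_good fr3; have ok3 := frame_slots fr3 isT ok2.
have cok3 := frame_codual fr3 isT cok2.
rewrite -[denot main s]/(denot (PAsg 0 (ENot (Reg 0))) s4).
rewrite -[LHS]/(nat_of_bool (regs s4 0 == 0)) -[_ == 0]negbK; congr (nat_of_bool (~~ _)).
rewrite (denot_redundant slot_le) // (denot_missed slot_le) //.
by rewrite (frame_regs fr2) // (frame_regs fr1) // r0.
Qed.

Definition positive_consts (rho : nat -> nat) : Prop :=
  forall r, constant_reg r -> 0 < rho r.

Definition time_in (p : prog) (X : (nat -> nat) -> nat) : Prop :=
  exists c, forall rho, positive_consts rho -> time rho p <= c * X rho.

Definition positive_bound (X : (nat -> nat) -> nat) : Prop :=
  forall rho, positive_consts rho -> 0 < X rho.

Lemma time_in_seq p1 p2 X : time_in p1 X -> time_in p2 X -> time_in (PSeq p1 p2) X.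
Proof.
move=> [c1 h1] [c2 h2]; exists (c1 + c2) => rho pos.
by rewrite /= mulnDl leq_add ?h1 ?h2.
Qed.

Lemma time_in_for r b p X : constant_reg b -> positive_bound X ->
  time_in p X -> time_in (PFor r b p) (fun rho => rho b * X rho).
Proof.
move=> cb pX [c h]; exists (14 + c) => rho pos.
have := h rho pos; have := pX rho pos; have := pos b cb; rewrite /=.
move: (rho b) (X rho) (time rho p) => k x T k0 x0 Tx.
have kT : k * T <= k * (c * x) by rewrite leq_mul2l Tx orbT.
by clear -kT k0 x0; nia.
Qed.

Lemma time_in_weaken p X Y d : time_in p X ->
  (forall rho, positive_consts rho -> X rho <= d * Y rho) -> time_in p Y.
Proof.
move=> [c h] XY; exists (c * d) => rho pos; apply: leq_trans (h rho pos) _.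
by rewrite -mulnA leq_mul2l XY ?orbT.
Qed.

Lemma time_in_const p c X : (forall rho, time rho p = c) -> positive_bound X ->
  time_in p X.
Proof. by move=> h pX; exists c => rho pos; rewrite h leq_pmulr ?pX. Qed.

Fixpoint loop_free (p : prog) : bool :=
  match p with
  | PSeq p1 p2 | PIf _ p1 p2 => loop_free p1 && loop_free p2
  | PFor _ _ _ => false
  | _ => true
  end.

Lemma time_in_loop_free p X : loop_free p -> positive_bound X -> time_in p X.
Proof.
move=> lf; apply: (@time_in_const _ (time id p)) => rho.
by elim: p lf => //= [p1 IH1 p2 IH2|e p1 IH1 p2 IH2] /andP[/IH1 -> /IH2 ->].
Qed.

Lemma time_in_fill q e : time_in (fill q e) (fun rho => rho 3 * (rho 3 * 1)).
Proof.
apply: time_in_for => //; first by move=> rho pos; rewrite muln1 pos.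
by apply: time_in_for => //; apply: time_in_loop_free.
Qed.

(** In order, the summands pay for [adjacency], [missed], the table fillings of [redundant], its
    loops over hyperedges, and [parse]. *)
Lemma time_in_main : time_in main (fun rho =>
  rho 2 ^ 3 * rho 5 ^ 2 + rho 2 * rho 1 ^ 3 + rho 1 ^ 2 * rho 3 ^ 2 + rho 1 * rho 2
  + rho 2 * rho 5).
Proof.
set Y := fun rho => _.
have pY : positive_bound Y.
  by move=> rho pos; rewrite /Y !addn_gt0 !muln_gt0 !pos // !orbT.
have wk p X : time_in p X -> (forall rho, positive_consts rho -> X rho <= Y rho) -> time_in p Y.
  by move=> tX XY; apply: (@time_in_weaken _ X Y 1) => // rho /XY; rewrite mul1n.
apply: time_in_seq; first apply: time_in_seq;
  last (apply: time_in_seq; last (apply: time_in_seq; last apply: time_in_seq)).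
- exact: time_in_loop_free.
- apply: (wk _ (fun rho => rho 2 * (rho 5 * 1))).
    apply: time_in_for => //; first by move=> rho pos; rewrite muln1 pos.
    apply: time_in_seq; last by apply: time_in_loop_free => // rho pos; rewrite muln1 pos.
    by apply: time_in_for => //; apply: time_in_loop_free.
  by move=> rho pos; rewrite /Y muln1 leq_addl.
- apply: (wk _ (fun rho => rho 2 * (rho 2 * (rho 5 * (rho 5 * (rho 2 * 1)))))).
    have p2 : positive_bound (fun rho => rho 2 * 1) by move=> rho pos; rewrite muln1 pos.
    have p52 : positive_bound (fun rho => rho 5 * (rho 2 * 1)).
      by move=> rho pos; rewrite muln_gt0 p2 ?pos.
    have p552 : positive_bound (fun rho => rho 5 * (rho 5 * (rho 2 * 1))).
      by move=> rho pos; rewrite muln_gt0 p52 ?pos.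
    have p2552 : positive_bound (fun rho => rho 2 * (rho 5 * (rho 5 * (rho 2 * 1)))).
      by move=> rho pos; rewrite muln_gt0 p552 ?pos.
    do 4 (apply: time_in_for => //).
    do 3 (apply: time_in_seq; first exact: time_in_loop_free).
    apply: time_in_seq; last exact: time_in_loop_free.
    by apply: time_in_for => //; apply: time_in_loop_free.
  move=> rho pos; rewrite /Y -!addnA; apply: leq_trans (leq_addr _ _).
  by apply: eq_leq; rewrite !expnS expn0; clear; nia.
- apply: (wk _ (fun rho => rho 2 * (rho 1 * (rho 1 * (rho 1 * 1))))).
    have p1 : positive_bound (fun rho => rho 1 * 1) by move=> rho pos; rewrite muln1 pos.
    have p11 : positive_bound (fun rho => rho 1 * (rho 1 * 1)).
      by move=> rho pos; rewrite muln_gt0 p1 ?pos.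
    have p111 : positive_bound (fun rho => rho 1 * (rho 1 * (rho 1 * 1))).
      by move=> rho pos; rewrite muln_gt0 p11 ?pos.
    do 4 (apply: time_in_for => //).
    exact: time_in_loop_free.
  move=> rho pos; rewrite /Y -!addnA addnCA; apply: leq_trans (leq_addr _ _).
  by apply: eq_leq; rewrite !expnS expn0; clear; nia.
(* The order of one 2-CNF: [rho 1] eliminations on a square table, plus one pass over the
   hyperedges. *)
- pose Z rho := rho 1 * (rho 3 * (rho 3 * 1)) + rho 2.
  have pZ : positive_bound Z by move=> rho pos; rewrite /Z addn_gt0 [0 < rho 2]pos ?orbT.
  apply: (wk _ (fun rho => rho 1 * Z rho)).
    apply: time_in_for => //.
    have fl q e : time_in (fill q e) Z.
      apply: (@time_in_weaken _ _ Z 1 (time_in_fill q e)) => rho pos; rewrite mul1n /Z.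
      by apply: leq_trans (leq_addr _ _); rewrite leq_pmull ?pos.
    apply: time_in_seq; first exact: fl.
    apply: time_in_seq.
      apply: (@time_in_weaken _ (fun rho => rho 2 * 1) Z 1).
        by apply: time_in_for => //; apply: time_in_loop_free.
      by move=> rho pos; rewrite mul1n muln1 /Z leq_addl.
    apply: time_in_seq; last exact: time_in_loop_free.
    apply: (@time_in_weaken _ (fun rho => rho 1 * (rho 3 * (rho 3 * 1))) Z 1).
      apply: time_in_for => //; first by move=> rho pos; rewrite muln1 muln_gt0 pos.
      by apply: time_in_seq; apply: time_in_fill.
    by move=> rho pos; rewrite mul1n /Z leq_addr.
  move=> rho pos; rewrite /Y /Z; clear.
  have -> : rho 1 * (rho 1 * (rho 3 * (rho 3 * 1)) + rho 2)
      = rho 1 ^ 2 * rho 3 ^ 2 + rho 1 * rho 2 by rewrite -!mulnn; nia.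
  by clear; lia.
- exact: time_in_loop_free.
Qed.

(** The bound [m <= 2 * (n * D)] trades two factors of [m ^ 3] for n and D, and [n <= 3 * m] trades
    one factor of n^4 for m. The coefficients add up to 36 and 53, within 100. *)
Lemma polynomial_bound n m D : 0 < n -> 0 < m -> m <= 2 * (n * D) -> n <= 3 * m ->
  m ^ 3 * 3 ^ 2 + m * n ^ 3 + n ^ 2 * n.*2.+2 ^ 2 + n * m + m * 3
  <= 100 * (m * n ^ 2 * D ^ 2 + m * n ^ 3).
Proof.
move=> n0 m0 mD nm.
have h1 : m ^ 3 <= 4 * (m * n ^ 2 * D ^ 2).
  have : m * m <= (2 * (n * D)) * (2 * (n * D)) by apply: leq_mul.
  rewrite -(leq_pmul2l m0) => h; apply: (leq_trans (leq_trans (eq_leq _) h)).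
    by rewrite !expnS expn0 muln1.
  by apply: eq_leq; rewrite -!mulnn; nia.
have h2 : n ^ 2 * n.*2.+2 ^ 2 <= 48 * (m * n ^ 3).
  have a : n.*2.+2 ^ 2 <= (4 * n) ^ 2 by rewrite leq_exp2r //; lia.
  have b : n ^ 2 * n.*2.+2 ^ 2 <= n ^ 2 * (4 * n) ^ 2 by rewrite leq_mul2l a orbT.
  apply: leq_trans b _; rewrite expnMn.
  have -> : n ^ 2 * (4 ^ 2 * n ^ 2) = 16 * (n * n ^ 3) by rewrite !expnS !expn0; nia.
  have c : n * n ^ 3 <= 3 * m * n ^ 3 by rewrite leq_mul2r nm orbT.
  by move: c; rewrite -mulnA; lia.
have h3 : n * m <= m * n ^ 3.
  by rewrite mulnC leq_mul2l -{1}[n]expn1 leq_pexp2l ?orbT.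
have h4 : m <= m * n ^ 3 by rewrite leq_pmulr // expn_gt0 n0.
by move: h1 h2 h3 h4; move: (m ^ 3) (m * n ^ 3) (n ^ 2 * _) (m * n ^ 2 * _) (n * m); lia.
Qed.

(** * Input encoding and the theorem *)

(** The constant registers are set before [main], since well-formed programs cannot write them. *)
Definition algorithm : cmd :=
  Seq (Assign 1 (Fetch (Num 0)))
  (Seq (Assign 2 (Fetch (Num 1)))
  (Seq (Assign 3 (Op OpAdd (Op OpAdd (Reg 1) (Reg 1)) (Num 2)))
  (Seq (Assign 4 (Op OpAdd (Op OpMul (Num 4) (Reg 2)) (Num 3)))
  (Seq (Assign 5 (Num 3)) (compile main))))).

Lemma mem_nth3 (d x : nat) s : size s <= 3 -> x != d ->
  [|| x == nth d s 0, x == nth d s 1 | x == nth d s 2] = (x \in s).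
Proof.
by case: s => [|a [|b [|c []]]] //= _ /negPf xd; rewrite ?inE ?xd ?orbF.
Qed.

Section Encoding.

Variables (V : finType) (E : {set {set V}}) (label : V -> 'I_#|V|) (es : seq (seq V)).
Hypothesis hypE : hypergraph E.
Hypothesis dimE : dimension E <= 3.
Hypothesis label_inj : injective label.
Hypothesis listE : edge_list E es.

Local Notation n := #|V|.
Local Notation m := (size es).
Local Notation N := (size (encode label es)).

Definition labelled_edges : seq (seq nat) := [seq [seq val (label v) | v <- e] | e <- es].

Local Notation t := (slot n labelled_edges).

Definition edge (i : nat) : {set V} := [set:: nth [::] es i].

Lemma vertices_gt0 : 0 < n.
Proof. by case/andP: hypE. Qed.

Lemma encode_blocks :
  encode label es = [:: n, size labelled_edges & flatten (blocks labelled_edges)].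
Proof.
rewrite /encode /blocks /labelled_edges size_map -map_comp; congr [:: _, _ & flatten _].
by apply: eq_map => e /=; rewrite size_map.
Qed.

Lemma edges_listP e : reflect (exists2 i, i < m & e = edge i) (e \in E).
Proof.
case/and3P: listE => _ _ /eqP ->; rewrite inE; apply: (iffP mapP) => [[s /(nthP [::])[i im <-] ->]|].
  by exists i.
by case=> i im ->; exists (nth [::] es i); rewrite ?mem_nth.
Qed.

Lemma card_edges : #|E| = m.
Proof.
case/and3P: listE => _ un /eqP ->; rewrite cardsE.
by rewrite (card_uniqP un) size_map.
Qed.

Lemma uniq_edge e : e \in es -> uniq e.
Proof. by case/and3P: listE => /allP h _ _ /h. Qed.

Lemma size_edge e : e \in es -> size e <= 3.
Proof.
move=> ein; have eE : [set:: e] \in E.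
  by case/and3P: listE => _ _ /eqP ->; rewrite inE map_f.
apply: leq_trans dimE; rewrite -(card_uniqP (uniq_edge ein)) -cardsE.
exact: (leq_bigmax_cond (F := fun e : {set V} => #|e|)).
Qed.

Lemma size_labelled e : e \in labelled_edges -> size e <= 3.
Proof. by case/mapP => s /size_edge h ->; rewrite size_map. Qed.

Lemma slot_nth i j : t i j = nth n [seq val (label v) | v <- nth [::] es i] j.
Proof.
rewrite /slot /labelled_edges; case: (ltnP i m) => im; first by rewrite (nth_map [::]).
by rewrite !(nth_default [::]) ?size_map.
Qed.

Lemma slot_mem_edge i v : i < m -> slot_mem t (label v) i = (v \in edge i).
Proof.
move=> im; rewrite /slot_mem !slot_nth mem_nth3; last 2 first.
- by rewrite size_map size_edge ?mem_nth.
- by rewrite neq_ltn ltn_ord.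
by rewrite inE (mem_map (f := fun v => val (label v))) //; apply: inj_comp val_inj label_inj.
Qed.

Lemma slot_cases i j : i < m -> t i j = n \/ exists v, t i j = label v.
Proof.
move=> im; rewrite slot_nth; case: (ltnP j (size (nth [::] es i))) => h; last first.
  by left; rewrite nth_default ?size_map.
have [v0 _] : exists v0 : V, v0 \in predT by apply/card_gt0P/vertices_gt0.
by right; exists (nth v0 (nth [::] es i) j); rewrite (nth_map v0).
Qed.

Lemma slot_distinct i j k : i < m -> j != k -> t i j = t i k -> t i j = n.
Proof.
move=> im jk; rewrite !slot_nth; set s := map _ _.
have us : uniq s.
  rewrite map_inj_uniq ?uniq_edge ?mem_nth //; exact: inj_comp val_inj label_inj.
case: (ltnP j (size s)) => js; last by rewrite nth_default.
case: (ltnP k (size s)) => ks; last by rewrite [in RHS]nth_default.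
by move/eqP; rewrite nth_uniq // (negPf jk).
Qed.

Lemma flatten_size_ge : n <= size (flatten es).
Proof.
rewrite cardE; apply: uniq_leq_size; first exact: enum_uniq.
move=> v _; have : v \in cover E by case/andP: hypE => _ /eqP ->; rewrite inE.
case/bigcupP => e /edges_listP[i im ->]; rewrite inE => vi.
by apply/flattenP; exists (nth [::] es i); rewrite ?mem_nth.
Qed.

Lemma flatten_size_le : size (flatten es) <= 3 * m.
Proof.
have : all (fun e => size e <= 3) es by apply/allP => e; apply: size_edge.
elim: es => //= e s IH /andP[e3 /IH h]; rewrite size_cat mulnS; exact: leq_add.
Qed.

Lemma size_encode : N = (m + size (flatten es)).+2.
Proof.
rewrite /= ; congr _.+2; elim: es => //= e s IH.
by rewrite !size_cat /= size_map IH; lia.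
Qed.

Lemma edges_gt0 : 0 < m.
Proof.
by have := leq_trans vertices_gt0 (leq_trans flatten_size_ge flatten_size_le); case: es.
Qed.

(** Counting incidences twice bounds the sum of the hyperedge sizes by n times the maximum degree.
    All hyperedges but possibly the empty one contribute to this sum, and the factor 2 absorbs that
    exception. *)
Lemma edges_le_degree : m <= 2 * (n * max_degree E).
Proof.
have sumD : \sum_(e in E) #|e| <= n * max_degree E.
  have -> : \sum_(e in E) #|e| = \sum_(v : V) degree E v.
    under eq_bigr => e _ do rewrite -sum1_card.
    rewrite (exchange_big_dep xpredT) //=; apply: eq_bigr => v _.
    rewrite /degree -sum1_card; apply: eq_bigl => e; by rewrite inE.
  rewrite -sum_nat_const; apply: leq_sum => v _; exact: leq_bigmax.
have D0 : 0 < n * max_degree E.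
  have [v _] : exists v0 : V, v0 \in predT by apply/card_gt0P/vertices_gt0.
  rewrite muln_gt0 vertices_gt0; apply: (leq_trans _ (leq_bigmax v)).
  have : v \in cover E by case/andP: hypE => _ /eqP ->; rewrite inE.
  by case/bigcupP => e eE ve; apply/card_gt0P; exists e; rewrite inE eE.
have : m <= 1 + \sum_(e in E) #|e|.
  rewrite -card_edges -sum1_card.
  apply: (@leq_trans (\sum_(e in E) ((e == set0) + #|e|))).
    by apply: leq_sum => e _; case: eqP => // /eqP; rewrite -card_gt0.
  rewrite big_split leq_add2r /= big_mkcond (bigD1 set0) //= eqxx big1 ?addn0.
    by case: ifP.
  by move=> e /negPf ->; case: ifP.
move=> le; rewrite mul2n -addnn; apply: leq_trans le _.
by rewrite leq_add.
Qed.

Lemma conformal_slots : conformal (dual E)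
  = ~~ (missed_index n m t || redundant_index n m t).
Proof.
apply: (conformal_indexE vertices_gt0 label_inj edges_listP slot_mem_edge).
  by move=> i j im _; apply: slot_cases.
by move=> i j k im _ _; apply: slot_distinct.
Qed.

(** Since [N] is at least 4, this also bounds [4 * N], hence the table address [4 * m + 3] and the
    row length. *)
Definition word_bound := N ^ 2.

Lemma size_encode_ge : n + m + 2 <= N.
Proof. by rewrite size_encode addn2 !ltnS addnC leq_add2l flatten_size_ge. Qed.

Lemma bounded_init : bounded word_bound (init (encode label es)).
Proof.
have NK : N <= word_bound by rewrite /word_bound -{1}[N]expn1 leq_pexp2l // size_encode.
split=> //= a; apply: leq_trans NK.
have [aN|Na] := ltnP a N; last by rewrite nth_default.
have : all (leq^~ N) (encode label es).
  have [nN mN N3] : [/\ n <= N, m <= N & 3 <= N].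
    have := size_encode_ge; have := vertices_gt0; have := edges_gt0.
    by move: N n m; clear => c x y x0 y0 sz; split; lia.
  rewrite /= nN mN /=; apply/allP => x /flattenP[_ /mapP[e ein ->]].
  rewrite inE => /orP[/eqP ->|/mapP[v _ ->]]; last by rewrite (leq_trans _ nN) // ltnW.
  exact: leq_trans (size_edge ein) N3.
by move/allP; apply; apply: mem_nth.
Qed.

Lemma algorithm_correct c :
  (forall rho, positive_consts rho -> rho 1 = n -> rho 2 = m -> rho 3 = n.*2.+2 ->
     rho 5 = 3 ->
     time rho main <= c * (m ^ 3 * 3 ^ 2 + m * n ^ 3 + n ^ 2 * n.*2.+2 ^ 2 + n * m + m * 3)) ->
  answers_within (N ^ 40) algorithm (encode label es)
    ((30 + c) * 100 * (#|E| * n ^ 2 * max_degree E ^ 2 + #|E| * n ^ 3))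
    (conformal (dual E)).
Proof.
move=> tm; have sz := size_encode_ge; have n0 := vertices_gt0; have m0 := edges_gt0.
have N2 : 1 < N by rewrite size_encode.
have K1 : 1 < word_bound by rewrite /word_bound (leq_trans N2) // -{1}[N]expn1 leq_pexp2l // ltnW.
have KW : word_bound ^ max_deg <= N ^ 40 by rewrite /word_bound -expnM.
set s0 := init (encode label es).
have b0 : bounded word_bound s0 := bounded_init.
have NK : 4 * N <= word_bound.
  rewrite /word_bound -mulnn leq_mul2r; apply/orP; right.
  by move: sz n0 m0; clear; move: N n m; lia.
have [nK [mK [LK [BK tK]]]] : n <= word_bound /\ m <= word_bound /\ n.*2.+2 <= word_bound /\
    4 * m + 3 <= word_bound /\ 3 <= word_bound.
  by move: sz n0 m0 NK; clear; move: word_bound N n m; lia.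
pose s1 := set_reg s0 1 n; pose s2 := set_reg s1 2 m.
pose s3 := set_reg s2 3 n.*2.+2; pose s4 := set_reg s3 4 (4 * m + 3).
pose s5 := set_reg s4 5 3.
have b1 : bounded word_bound s1 by apply: bounded_set_reg.
have b2 : bounded word_bound s2 by apply: bounded_set_reg.
have b3 : bounded word_bound s3 by apply: bounded_set_reg.
have b4 : bounded word_bound s4 by apply: bounded_set_reg.
have b5 : bounded word_bound s5 by apply: bounded_set_reg.
have g5 : good n m s5 by [].
have [_ [t5 le5 ex5]] := exec_compile K1 KW wf_main b5.
have asg s r e v : bounded word_bound s -> fits_deg e -> eval s e = v ->
    exec (N ^ 40) (Assign r e) s (cost e).+1 (set_reg s r v).
  by move=> bs fe <-; constructor; apply: fits_degP bs fe.
(* The five initial assignments take 20 steps, covered by the 30 in the constant. *)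
exists (3 + (3 + (6 + (6 + (2 + t5))))), (denot main s5); split.
- rewrite /algorithm; apply: (ExecSeq (asg s0 1 (Fetch (Num 0)) n b0 isT erefl)).
  apply: (ExecSeq (asg s1 2 (Fetch (Num 1)) m b1 isT erefl)).
  have e3 : eval s2 (Op OpAdd (Op OpAdd (Reg 1) (Reg 1)) (Num 2)) = n.*2.+2.
    by rewrite -[RHS]addn2 -addnn.
  apply: (ExecSeq (asg s2 3 (Op OpAdd (Op OpAdd (Reg 1) (Reg 1)) (Num 2)) _ b2 isT e3)).
  apply: (ExecSeq (asg s3 4 (Op OpAdd (Op OpMul (Num 4) (Reg 2)) (Num 3)) (4 * m + 3) b3 isT erefl)).
  exact: (ExecSeq (asg s4 5 (Num 3) 3 b4 isT erefl)).
- have le := tm (regs s5) _ erefl erefl erefl erefl.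
  have {}le : t5 <= c * (m ^ 3 * 3 ^ 2 + m * n ^ 3 + n ^ 2 * n.*2.+2 ^ 2 + n * m + m * 3).
    apply: leq_trans le5 (le _) => r; rewrite /constant_reg /s5 /=.
    by case: r => [|[|[|[|[|[|r]]]]]] //= _; rewrite addn3.
  have P := polynomial_bound n0 m0 edges_le_degree (leq_trans flatten_size_ge flatten_size_le).
  rewrite card_edges -mulnA; apply: leq_trans (leq_mul (leqnn _) P).
  set X := _ + m * 3 in le *; have X0 : 0 < X by rewrite /X addn_gt0 muln_gt0 m0 orbT.
  by move: X X0 le => X X0 le; rewrite mulnDl; clear -X0 le; lia.
- rewrite conformal_slots -[m](size_map (fun e => [seq val (label v) | v <- e])).
  apply: denot_main => //; first exact: size_labelled.
  + move=> i j; rewrite size_map => im _; case: (slot_cases j im) => [->//|[v ->]].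
    by rewrite ltnW.
  + by rewrite size_map.
  + by move=> a; rewrite -encode_blocks.
Qed.

End Encoding.

(* Words are polynomially bounded in the length of the input, that is, they
   have a logarithmic number of bits. *)
Theorem theorem5p4 :
  exists (p : cmd) (k C : nat),
    forall (V : finType) (E : {set {set V}}) (label : V -> 'I_#|V|)
           (es : seq (seq V)),
      hypergraph E ->
      dimension E <= 3 ->
      injective label ->
      edge_list E es ->
      answers_within (size (encode label es) ^ k) p (encode label es)
        (C * (#|E| * #|V| ^ 2 * max_degree E ^ 2 + #|E| * #|V| ^ 3))
        (conformal (dual E)).
Proof.
have [c tm] := time_in_main.
exists algorithm, 40, ((30 + c) * 100) => V E label es hypE dimE label_inj listE.
apply: algorithm_correct => // rho pos r1 r2 r3 r5.
by have := tm rho pos; rewrite r1 r2 r3 r5.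
Qed.
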